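(* The following group properties (index laws) are valid: $$B_{\nu,-}^{-\alpha}B_{\nu,-}^{-\beta}f=B_{\nu,-}^{-(\alpha+\beta)}f,$$ $$B_{\nu,0+}^{-\alpha}B_{\nu,0+}^{-\beta}f=B_{\nu,0+}^{-(\alpha+\beta)}f.$$
   Context: Let $\nu\ge0$. For an order $\gamma>0$ (here $\gamma=\alpha$, $\beta$ or $\alpha+\beta$), the right-sided fractional Bessel integral on the half-axis is defined for $f\in C^{[2\gamma]+1}(0,+\infty)$ by $$(B_{\nu,-}^{-\gamma}f)(x)=\frac{1}{\Gamma(2\gamma)}\int_x^\infty\left(\frac{y^2-x^2}{2y}\right)^{2\gamma-1}{}_2F_1\left(\gamma+\frac{\nu-1}{2},\gamma;2\gamma;1-\frac{x^2}{y^2}\right)f(y)\,dy,$$ and the left-sided fractional Bessel integral is defined for $f\in C^{[2\gamma]+1}[0,+\infty)$ by $$(B_{\nu,0+}^{-\gamma}f)(x)=\frac{1}{\Gamma(2\gamma)}\int_0^x\left(\frac{y}{x}\right)^\nu\left(\frac{x^2-y^2}{2x}\right)^{2\gamma-1}{}_2F_1\left(\gamma+\frac{\nu-1}{2},\gamma;2\gamma;1-\frac{y^2}{x^2}\right)f(y)\,dy,$$ where ${}_2F_1$ is the Gauss hypergeometric function and $[2\gamma]$ is the integer part of $2\gamma$. These are negative fractional powers of the Bessel operator $B_\nu=\frac{d^2}{dx^2}+\frac{\nu}{x}\frac{d}{dx}$.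
   Formalization: For the right-sided law, f is also assumed to make the integral defining B_{ν,-}^{-(α+β)}f absolutely convergent for every x>0, since smoothness alone does not ensure it exists (it diverges for f=1); the left-sided law needs no addition. *)

(* Defs.v *)
From HB Require Import structures.
From mathcomp Require Import all_boot all_order all_algebra.
From mathcomp Require Import all_classical all_reals all_analysis.
Set Implicit Arguments.
Unset Strict Implicit.
Unset Printing Implicit Defensive.
Import Order.TTheory GRing.Theory Num.Theory.
Import numFieldNormedType.Exports.
Local Open Scope classical_set_scope.
Local Open Scope ring_scope.

(* [f] is of class C^k on the interval [D], where [d j] is the j-th derivative.
   Limits are taken inside [D], so derivatives at an endpoint belonging to [D]
   are one-sided; nothing is required of [f] outside [D]. *)
Definition C_on (R : realType) (k : nat) (D : set R) (f : R -> R) : Prop :=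
  exists d : nat -> R -> R,
    [/\ forall x, D x -> d 0%N x = f x,
        forall j x, (j < k)%N -> D x ->
          (d j y - d j x) / (y - x) @[y --> within D x^'] --> d j.+1 x
      & forall j, (j <= k)%N -> {within D, continuous (d j)}].

(* Euler's integral, used for s > 0. *)
Definition Gamma (R : realType) (s : R) : R :=
  \int[lebesgue_measure]_(t in `]0, +oo[) (t `^ (s - 1) * expR (- t)).

Definition rising (R : realType) (a : R) (n : nat) : R :=
  \prod_(i < n) (a + i%:R).

(* Sum of the Gauss series. It is only evaluated at 0 < t < 1 with c > 0, so no
   analytic continuation is needed. *)
Definition hyp2F1 (R : realType) (a b c t : R) : R :=
  limn (series (fun n : nat =>
    rising a n * rising b n / (rising c n * n`!%:R) * t ^+ n)).

Definition bessel_right_integrand (R : realType) (nu gamma : R) (f : R -> R)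
    (x y : R) : R :=
  ((y ^+ 2 - x ^+ 2) / (2 * y)) `^ (2 * gamma - 1)
  * hyp2F1 (gamma + (nu - 1) / 2) gamma (2 * gamma) (1 - x ^+ 2 / y ^+ 2)
  * f y.

Definition bessel_right (R : realType) (nu gamma : R) (f : R -> R) (x : R) : R :=
  (Gamma (2 * gamma))^-1 *
  \int[lebesgue_measure]_(y in `]x, +oo[) bessel_right_integrand nu gamma f x y.

(* [Rintegral] is total; this says that the integral really converges. *)
Definition bessel_right_cvg (R : realType) (nu gamma : R) (f : R -> R) : Prop :=
  forall x : R, 0 < x ->
    lebesgue_measure.-integrable `]x, +oo[
      (fun y => (bessel_right_integrand nu gamma f x y)%:E).

Definition bessel_left_integrand (R : realType) (nu gamma : R) (f : R -> R)
    (x y : R) : R :=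
  (y / x) `^ nu
  * ((x ^+ 2 - y ^+ 2) / (2 * x)) `^ (2 * gamma - 1)
  * hyp2F1 (gamma + (nu - 1) / 2) gamma (2 * gamma) (1 - y ^+ 2 / x ^+ 2)
  * f y.

Definition bessel_left (R : realType) (nu gamma : R) (f : R -> R) (x : R) : R :=
  (Gamma (2 * gamma))^-1 *
  \int[lebesgue_measure]_(y in `]0, x[) bessel_left_integrand nu gamma f x y.

Definition bessel_left_cvg (R : realType) (nu gamma : R) (f : R -> R) : Prop :=
  forall x : R, 0 < x ->
    lebesgue_measure.-integrable `]0, x[
      (fun y => (bessel_left_integrand nu gamma f x y)%:E).

(* Main.v *)
Require Import Defs.
From HB Require Import structures.
From mathcomp Require Import all_boot all_order all_algebra.
From mathcomp Require Import all_classical all_reals all_analysis.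
From mathcomp Require Import measurable_realfun ring lra.
Set Implicit Arguments.
Unset Strict Implicit.
Unset Printing Implicit Defensive.
Import Order.TTheory GRing.Theory Num.Theory.
Import numFieldNormedType.Exports.
Local Open Scope classical_set_scope.
Local Open Scope ring_scope.

(** Both fractional integrals have nonnegative kernels, so each index law
amounts to the semigroup law of the kernels plus Fubini.

In the variables u = x^2, w = z^2 the Bessel operator is
4 w^(-mu) (d/dw) w^(mu+1) (d/dw) with mu = (nu-1)/2, and its power -g factors
through two Weyl fractional integrals W^g (kernels (w-u)_+^(g-1) / Gamma(g)):
4^(-g) W^g v^(-g-mu) W^g w^mu. Substituting v = w - (w-u)s in the kernel of
this product gives Euler's integral of the Gauss series, so it is the kernel
of the statement (right_kernel_hyp2F1, from euler_integral). In this form the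
semigroup law is algebra: the W^g form a semigroup by the Beta integral
(kcomp_riesz), and the substitution v -> uw/v exchanges the two middle factors
(riesz_inversion); bessel_core_semigroup combines the two. The left kernel at
(x, y) is (y/x)^nu times the right kernel at (y, x), so it inherits the law
with the two orders exchanged.

The rest is convergence. By Euler's integral the kernels are nonnegative for
every nu >= 0, including the case where a parameter of the Gauss series is
negative, so Tonelli applies to |f|. On the left f is bounded on [0, x] and the
kernel applied to the constant 1 is an explicit product of Beta integrals
(integral_left_kernel_lty). On the right, convergence for alpha + beta at x/2
gives, by Tonelli, convergence for beta at almost every y0 > x/2; it passes
from some y0 < x to x because at a fixed order the kernels based at x and at
y0 are comparable at infinity (le_right_kernel_shift), while near x the kernel
is at most C (z-x)^(2 beta - 1) (right_kernel_near). *)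

(** * Affine substitution and Tonelli for the Lebesgue measure *)

Section Lebesgue.
Context {R : realType}.
Local Notation leb := (@lebesgue_measure R).
Local Open Scope ereal_scope.

(** The image of the Lebesgue measure under the substitution agrees, up to the
factor, with the Lebesgue measure on half-open intervals, hence everywhere.
Unlike a substitution by primitives this asks no continuity of the integrand. *)
Lemma ge0_integral_affine (r c : R) (f : R -> \bar R) : r != 0%R ->
  measurable_fun setT f -> (forall x, 0 <= f x) ->
  \int[leb]_x f (r * x + c)%R = (`|r|^-1)%:E * \int[leb]_x f x.
Proof.
move=> r0 mf f0.
pose phi := (fun x : R => r * x + c)%R : measurableTypeR R -> measurableTypeR R.
have mphi : measurable_fun setT phi.
  by apply: measurable_funD => //; apply: measurable_funM.
have nr0 : (0 <= `|r|)%R by [].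
have E A : measurable A -> leb A = `|r|%:E * leb (phi @^-1` A).
  move=> mA; unshelve refine
    (@lebesgue_measure_unique R (mscale (NngNum nr0) (pushforward leb phi)) _ A mA).
    exact: mphi.
  move=> /= _ [[a b]] _ <-.
  rewrite /mscale /= /pushforward /=.
  have [rp|rn|/eqP] := ltgtP r 0%R; last by rewrite (negbTE r0).
  - rewrite (_ : phi @^-1` _ = `[(b - c) / r, (a - c) / r[%classic)%R; last first.
      apply/seteqP; split => x /=; rewrite !in_itv /= /phi => /andP[h1 h2];
        apply/andP; split.
      + by rewrite ler_ndivrMr//; lra.
      + by rewrite ltr_ndivlMr//; lra.
      + by move: h2; rewrite ltr_ndivlMr//; lra.
      + by move: h1; rewrite ler_ndivrMr//; lra.
    rewrite !lebesgue_measure_itv /= !lte_fin ltr_ndivrMr// divfK//.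
    rewrite ltrD2r; case: ifPn => // ab; last by rewrite mule0.
    rewrite -!EFinD -EFinM ltr0_norm//; congr _%:E; field.
    by rewrite lt_eqF.
  - rewrite (_ : phi @^-1` _ = `](a - c) / r, (b - c) / r]%classic)%R; last first.
      apply/seteqP; split => x /=; rewrite !in_itv /= /phi => /andP[h1 h2];
        apply/andP; split.
      + by rewrite ltr_pdivrMr//; lra.
      + by rewrite ler_pdivlMr//; lra.
      + by move: h1; rewrite ltr_pdivrMr//; lra.
      + by move: h2; rewrite ler_pdivlMr//; lra.
    rewrite !lebesgue_measure_itv /= !lte_fin ltr_pdivrMr// divfK//.
    rewrite ltrD2r; case: ifPn => // ab; last by rewrite mule0.
    rewrite -!EFinD -EFinM gtr0_norm//; congr _%:E; field.
    by rewrite gt_eqF.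
have H := ge0_integral_pushforward mphi leb measurableT mf (fun x _ => f0 x).
rewrite preimage_setT in H; rewrite -[LHS]H.
have nr1 : (0 <= `|r|^-1)%R by rewrite invr_ge0.
rewrite -(ge0_integral_mscale leb measurableT (NngNum nr1))//.
apply: eq_measure_integral => A mA _.
transitivity ((`|r|^-1)%:E * leb A); last by [].
by rewrite /pushforward E// muleA -EFinM mulVf ?normr_eq0// mul1e.
Qed.

Lemma tonelli (f : R -> R -> \bar R) :
  measurable_fun setT (fun p : R * R => f p.1 p.2) ->
  (forall x y, 0 <= f x y) ->
  \int[leb]_x \int[leb]_y f x y = \int[leb]_y \int[leb]_x f x y.
Proof.
move=> mf f0.
exact: (fubini_tonelli (m1 := leb) (m2 := leb) (fun p => f p.1 p.2) mf
  (fun p => f0 p.1 p.2)).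
Qed.

Lemma measurable_integral3 (f : R -> R -> R -> \bar R) :
  measurable_fun setT (fun p : (R * R) * R => f p.1.1 p.1.2 p.2) ->
  (forall x y z, 0 <= f x y z) ->
  measurable_fun setT (fun p : R * R => \int[leb]_z f p.1 p.2 z).
Proof.
move=> mf f0.
exact: (measurable_fun_fubini_tonelli_F (m2 := leb)
  (fun p : (R * R) * R => f p.1.1 p.1.2 p.2) mf (fun p => f0 p.1.1 p.1.2 p.2)).
Qed.

End Lebesgue.

(** * Truncated powers *)

Section PositivePart.
Context {R : realType}.
Local Notation leb := (@lebesgue_measure R).

(** The function x_+^p. Extending by 0 turns integrals over variable intervals
into convolutions over the whole line. *)
Definition ppow (p x : R) : R := if 0 < x then x `^ p else 0.

Lemma ppow_ge0 p x : 0 <= ppow p x.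
Proof. by rewrite /ppow; case: ifP => // _; exact: powR_ge0. Qed.

Lemma ppow_ge0E p x : (0 <= (ppow p x)%:E)%E.
Proof. by rewrite lee_fin ppow_ge0. Qed.

Lemma ppowE p x : 0 < x -> ppow p x = x `^ p.
Proof. by rewrite /ppow => ->. Qed.

Lemma ppow_npos p x : x <= 0 -> ppow p x = 0.
Proof. by rewrite /ppow; case: ltgtP. Qed.

Lemma measurable_ppow p : measurable_fun setT (ppow p).
Proof.
apply: measurable_fun_if => //.
- by apply: measurable_fun_ltr.
- by apply: measurable_funTS; exact: measurable_powR.
Qed.

Lemma ppowMl p r x : 0 < r -> ppow p (r * x) = r `^ p * ppow p x.
Proof.
move=> r0; rewrite /ppow pmulr_rgt0//; case: ifP => [x0|]; last by rewrite mulr0.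
by rewrite powRM// ltW.
Qed.

Lemma ppowD p q x : ppow p x * ppow q x = ppow (p + q) x.
Proof.
rewrite /ppow; case: ifPn => [x0|]; last by rewrite mulr0.
by rewrite -powRD// (gt_eqF x0) implybT.
Qed.

Lemma ppowN1 x : 0 < x -> ppow (-1) x = x^-1.
Proof. by move=> x0; rewrite ppowE// powR_inv1// ltW. Qed.

Local Open Scope ereal_scope.

Lemma measurable_ppowE d (T : measurableType d) p (g : T -> R) :
  measurable_fun setT g -> measurable_fun setT (fun x => (ppow p (g x))%:E).
Proof.
by move=> mg; apply/measurable_EFinP; apply: measurableT_comp => //; exact: measurable_ppow.
Qed.

End PositivePart.

Ltac meas_step :=
  match goal with
  | |- measurable_fun _ (fun _ => (_ * _)%E) => apply: emeasurable_funM
  | |- measurable_fun _ (fun _ => (ppow _ _)%:E) => apply: measurable_ppowE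
  | |- measurable_fun _ (fun _ => (_)%:E) => apply/measurable_EFinP
  | |- measurable_fun _ (fun _ => (_ * _)%R) => apply: measurable_funM
  | |- measurable_fun _ (fun _ => (_ - _)%R) => apply: measurable_funB
  | |- measurable_fun _ (fun _ => (_ + _)%R) => apply: measurable_funD
  | |- measurable_fun _ (fun p => p.1) => exact: measurable_fst
  | |- measurable_fun _ (fun p => p.2) => exact: measurable_snd
  | |- measurable_fun _ (fun p => (@?g p).1) =>
      apply: (measurableT_comp measurable_fst)
  | |- measurable_fun _ (fun p => (@?g p).2) =>
      apply: (measurableT_comp measurable_snd)
  | |- measurable_fun _ (fun p => (@?g p) `^ _)%R =>
      apply: (measurableT_comp (@measurable_powR _ _))
  | |- measurable_fun _ (fun p => ?F (@?g p)) =>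
      apply: (@measurableT_comp _ _ _ _ _ _ F)
  end.
Ltac meas_hyp :=
  match goal with
  | H : measurable_fun _ _ |- _ => exact: H
  | H : forall _, measurable_fun _ _ |- _ => exact: H
  end.
Ltac meas := repeat first [done | meas_hyp | meas_step].

(** * Power substitutions by invariance of dx/x *)

Section MultiplicativeHaar.
Context {R : realType}.
Local Notation leb := (@lebesgue_measure R).
Local Open Scope ereal_scope.

(** Invariance of dx/x under scaling is all that the power substitutions below
need: they follow by the argument that proves uniqueness of Haar measure. *)
Lemma haar_scale (F : R -> \bar R) (r : R) : (0 < r)%R ->
  measurable_fun setT F -> (forall x, 0 <= F x) ->
  \int[leb]_x ((ppow (-1) x)%:E * F (r * x)%R) =
  \int[leb]_x ((ppow (-1) x)%:E * F x).
Proof.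
move=> r0 mF F0.
have mG : measurable_fun setT (fun x => (ppow (-1) x)%:E * F x).
  by apply: emeasurable_funM => //; exact: measurable_ppowE.
have := @ge0_integral_affine R r 0%R (fun x => (ppow (-1) x)%:E * F x).
rewrite gt_eqF// => /(_ isT mG (fun x => mule_ge0 (ppow_ge0E _ x) (F0 x))).
under eq_integral => x _ do
  rewrite addr0 ppowMl// EFinM -muleA powR_inv1 ?ltW//.
rewrite ge0_integralZl//; last 3 first.
- apply: emeasurable_funM; first exact: measurable_ppowE.
  by apply: measurableT_comp => //; exact: measurable_funM.
- by move=> x _; apply: mule_ge0 => //; exact: ppow_ge0E.
- by rewrite lee_fin invr_ge0 ltW.
rewrite gtr0_norm// => H.
have := congr1 (fun z => r%:E * z) H.
by rewrite !muleA -!EFinM divff ?gt_eqF// !mul1e.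
Qed.

(* An auxiliary function whose integral against dx/x is 1. *)
Let h (x : R) : R := if (0 < x < 1)%R then x else 0%R.

Let h_ge0 x : 0 <= (h x)%:E.
Proof. by rewrite lee_fin /h; case: ifP => // /andP[/ltW]. Qed.

Let mh : measurable_fun setT h.
Proof.
apply: measurable_fun_if => //.
apply: measurable_and; exact: measurable_fun_ltr.
Qed.

Let mhE : measurable_fun setT (EFin \o h).
Proof. exact/measurable_EFinP. Qed.

Let haar_h : \int[leb]_x ((ppow (-1) x)%:E * (h x)%:E) = 1.
Proof.
transitivity (\int[leb]_x (\1_(`]0%R, 1%R[%classic : set R) x)%:E).
  apply: eq_integral => x _; rewrite -EFinM indicE mem_setE in_itv /= /h.
  case: ifPn => [/andP[x0 x1]|]; last by rewrite mulr0.
  by rewrite ppowN1// mulVf// gt_eqF.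
by rewrite integral_indic ?setIT//= lebesgue_measure_itv/= lte_fin ltr01 sube0.
Qed.

Let haar_hscale y : (0 < y)%R ->
  \int[leb]_s ((ppow (-1) s)%:E * (h (y * s))%:E) = 1.
Proof. by move=> y0; rewrite (haar_scale (F := EFin \o h))// haar_h. Qed.

(** Insert the factor 1 = int h(y s) ds/s under the integral in y, exchange
the integrals, and replace y by y/s: the inner integral becomes that of
F(s/y) in s, which is the integral of F by scaling. *)
Lemma haar_inv (F : R -> \bar R) :
  measurable_fun setT F -> (forall x, 0 <= F x) ->
  \int[leb]_x ((ppow (-1) x)%:E * F (x `^ (-1))%R) =
  \int[leb]_x ((ppow (-1) x)%:E * F x).
Proof.
move=> mF F0.
transitivity (\int[leb]_y \int[leb]_s ((ppow (-1) y)%:E * F (y `^ (-1))%R *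
    ((ppow (-1) s)%:E * (h (y * s))%:E))).
  apply: eq_integral => y _; rewrite ge0_integralZl//; last 3 first.
  - by meas.
  - by move=> s _; rewrite mule_ge0// ppow_ge0E.
  - by rewrite mule_ge0// ppow_ge0E.
  have [y0|y0] := ltP 0%R y; last by rewrite ppow_npos// !mul0e.
  by rewrite haar_hscale// mule1.
rewrite tonelli; last 2 first.
- by meas.
- by move=> x y; rewrite !mule_ge0// ppow_ge0E.
pose G s y := F (y `^ (-1) * s)%R * (h y)%:E.
have mG : measurable_fun setT (fun p : R * R => G p.1 p.2).
  by rewrite /G; meas.
have mGs s : measurable_fun setT (G s) by rewrite /G; meas.
have G0 s y : 0 <= G s y by rewrite mule_ge0.
transitivity (\int[leb]_s \int[leb]_y
    ((ppow (-1) s)%:E * ((ppow (-1) y)%:E * G s y))).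
  apply: eq_integral => s _.
  have [s0|s0] := ltP 0%R s; last first.
    by apply: eq_integral => y _; rewrite (ppow_npos _ s0) !mul0e !mule0.
  rewrite [RHS]ge0_integralZl//; last 3 first.
  - by meas.
  - by move=> y _; rewrite mule_ge0// ppow_ge0E.
  - by rewrite ppow_ge0E.
  rewrite -(haar_scale s0 (mGs s) (G0 s)) -ge0_integralZl//; last 3 first.
  - by meas.
  - by move=> y _; rewrite mule_ge0// ppow_ge0E.
  - by rewrite ppow_ge0E.
  apply: eq_integral => y _.
  have [y0|y0] := ltP 0%R y; last by rewrite (ppow_npos _ y0) !mul0e !mule0.
  rewrite /G powRM ?ltW// (_ : (s `^ (-1) * y `^ (-1) * s) = y `^ (-1))%R; last first.
    by rewrite mulrAC powR_inv1 ?ltW// mulVf ?gt_eqF// mul1r.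
  by rewrite [(y * s)%R]mulrC -!muleA [in RHS]muleCA; congr (_ * _); exact: muleCA.
rewrite tonelli; last 2 first.
- by meas.
- by move=> x y; rewrite !mule_ge0// ppow_ge0E.
transitivity (\int[leb]_y ((ppow (-1) y)%:E * (h y)%:E *
    \int[leb]_x ((ppow (-1) x)%:E * F x))); last first.
  rewrite ge0_integralZr//.
  - by rewrite haar_h mul1e.
  - by meas.
  - by move=> y _; rewrite mule_ge0// ppow_ge0E.
  - by apply: integral_ge0 => y _; rewrite mule_ge0// ppow_ge0E.
apply: eq_integral => y _.
have [y0|y0] := ltP 0%R y; last first.
  rewrite (ppow_npos _ y0) !mul0e.
  by under eq_integral do rewrite mul0e mule0; rewrite integral0.
rewrite -(haar_scale (@powR_gt0 _ _ (-1) y0) mF F0) -ge0_integralZl//; last 3 first.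
- by meas.
- by move=> s _; rewrite mule_ge0// ppow_ge0E.
- by rewrite mule_ge0// ppow_ge0E.
apply: eq_integral => s _; rewrite /G.
by rewrite [RHS]muleCA -muleA; congr (_ * (_ * _)); exact: muleC.
Qed.

Lemma continuous_powR (a x : R) : (0 < x)%R ->
  {for x, continuous (fun y : R => y `^ a)%R}.
Proof.
move=> x0; apply: differentiable_continuous; apply/derivable1_diffP.
by apply: derivable_powR; rewrite in_itv/= andbT.
Qed.

(** The inversion x -> 1/x moves the singular endpoint to infinity, where the
fundamental theorem of calculus on a half-line applies. *)
Lemma integral_ppow01 (p : R) : (0 < p)%R ->
  \int[leb]_x ((ppow (-1) x)%:E * (ppow p x * \1_(`]0%R, 1%R[%classic : set R) x)%:E)
  = (p^-1)%:E.
Proof.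
move=> p0; rewrite -haar_inv; last 2 first.
- meas; exact: measurable_ppow.
- by move=> x; rewrite lee_fin mulr_ge0// ppow_ge0.
transitivity (\int[leb]_(x in `]1%R, +oo[) (x `^ (- p - 1))%:E).
  rewrite [RHS]integral_mkcond; apply: eq_integral => x _.
  rewrite /patch mem_setE in_itv/= andbT.
  have [x0|x0] := ltP 0%R x; last first.
    by rewrite ppow_npos// mul0e ifF//; lra.
  rewrite indicE mem_setE in_itv/= powR_gt0//= {2}powR_inv1 ?ltW//.
  rewrite invf_lt1//; case: ifPn => x1; last by rewrite mulr0 mule0.
  rewrite mulr1 -EFinM !ppowE ?powR_gt0// -powRrM mulN1r -powRD//.
    by rewrite addrC.
  by rewrite (gt_eqF x0) implybT.
rewrite integral_itv_obnd_cbnd; last first.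
  by apply/measurable_EFinP; apply: measurable_funTS; exact: measurable_powR.
rewrite (@ge0_continuous_FTC2y _ _ (fun x => - p^-1 * x `^ (- p))%R 1%R 0%R).
- by rewrite powR1 mulr1 sub0e -EFinN opprK.
- by move=> x _; exact: powR_ge0.
- apply: continuous_in_subspaceT => x; rewrite inE/= in_itv/= andbT => x1.
  by apply: continuous_powR; lra.
- rewrite -(mulr0 (- p^-1)%R); apply: cvgM; first exact: cvg_cst.
  apply/cvgrPdist_le => e e0.
  exists (e^-1 `^ p^-1)%R; split; first by rewrite num_real.
  move=> x /= ex; have x0 : (0 < x)%R by apply: le_lt_trans ex; exact: powR_ge0.
  rewrite sub0r normrN ger0_norm ?powR_ge0// powRN.
  rewrite -(invrK e) lef_pV2 ?posrE ?invr_gt0 ?powR_gt0//.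
  rewrite -(powRr1 (_ : 0 <= e^-1)%R) ?invr_ge0 ?ltW//.
  rewrite -(@mulVf _ p) ?gt_eqF// powRrM.
  by apply: (gt0_ltr_powR p0); rewrite ?nnegrE ?powR_ge0// ltW.
- move=> x x1; apply: derivableM => //.
  by apply: derivable_powR; rewrite in_itv/= andbT; lra.
- apply: cvg_at_right_filter; apply: cvgM; first exact: cvg_cst.
  exact: continuous_powR.
- move=> x; rewrite in_itv/= andbT => x1.
  have x0 : (0 < x)%R by lra.
  rewrite derive1E deriveM//; last by apply: derivable_powR; rewrite in_itv/= andbT.
  rewrite derive_val; have [_ ->] := is_derive1_powR (- p) x0.
  by rewrite scaler0 addr0 /GRing.scale/= mulrA mulrNN mulVf ?gt_eqF// mul1r.
Qed.

(** Same argument as for the inversion, with 1 = int h(y^p s) ds/s; the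
constant 1/p is the integral of h(y^p) against dy/y. *)
Lemma haar_pow (p : R) (F : R -> \bar R) : (0 < p)%R ->
  measurable_fun setT F -> (forall x, 0 <= F x) ->
  \int[leb]_x ((ppow (-1) x)%:E * F (x `^ p)%R) =
  (p^-1)%:E * \int[leb]_x ((ppow (-1) x)%:E * F x).
Proof.
move=> p0 mF F0.
transitivity (\int[leb]_y \int[leb]_s ((ppow (-1) y)%:E * F (y `^ p)%R *
    ((ppow (-1) s)%:E * (h (y `^ p * s))%:E))).
  apply: eq_integral => y _; rewrite ge0_integralZl//; last 3 first.
  - by meas.
  - by move=> s _; rewrite mule_ge0// ppow_ge0E.
  - by rewrite mule_ge0// ppow_ge0E.
  have [y0|y0] := ltP 0%R y; last by rewrite ppow_npos// !mul0e.
  by rewrite haar_hscale ?powR_gt0// mule1.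
rewrite tonelli; last 2 first.
- by meas.
- by move=> x y; rewrite !mule_ge0// ppow_ge0E.
pose G s y := F (y `^ p * s `^ (-1))%R * (h (y `^ p))%:E.
have mG : measurable_fun setT (fun p : R * R => G p.1 p.2).
  by rewrite /G; meas.
have mGs s : measurable_fun setT (G s) by rewrite /G; meas.
have G0 s y : 0 <= G s y by rewrite mule_ge0.
transitivity (\int[leb]_s \int[leb]_y
    ((ppow (-1) s)%:E * ((ppow (-1) y)%:E * G s y))).
  apply: eq_integral => s _.
  have [s0|s0] := ltP 0%R s; last first.
    by apply: eq_integral => y _; rewrite (ppow_npos _ s0) !mul0e !mule0.
  rewrite [RHS]ge0_integralZl//; last 3 first.
  - by meas.
  - by move=> y _; rewrite mule_ge0// ppow_ge0E.
  - by rewrite ppow_ge0E.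
  rewrite -(haar_scale (@powR_gt0 _ _ p^-1 s0) (mGs s) (G0 s)) -ge0_integralZl//; last 3 first.
  - by meas.
  - by move=> y _; rewrite mule_ge0// ppow_ge0E.
  - by rewrite ppow_ge0E.
  apply: eq_integral => y _.
  have [y0|y0] := ltP 0%R y; last by rewrite (ppow_npos _ y0) !mul0e !mule0.
  rewrite /G powRM ?ltW ?powR_gt0// -powRrM mulVf ?gt_eqF// powRr1 ?ltW//.
  rewrite (_ : (s * y `^ p * s `^ (-1)) = y `^ p)%R; last first.
    by rewrite mulrAC powR_inv1 ?ltW// mulfV ?gt_eqF// mul1r.
  by rewrite [(y `^ p * s)%R]mulrC -!muleA [in RHS]muleCA; congr (_ * _); exact: muleCA.
rewrite tonelli; last 2 first.
- by meas.
- by move=> x y; rewrite !mule_ge0// ppow_ge0E.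
transitivity (\int[leb]_y ((ppow (-1) y)%:E * (h (y `^ p))%:E *
    \int[leb]_x ((ppow (-1) x)%:E * F x))); last first.
  rewrite ge0_integralZr//; last 3 first.
  - by meas.
  - by move=> y _; rewrite mule_ge0// ppow_ge0E.
  - by apply: integral_ge0 => y _; rewrite mule_ge0// ppow_ge0E.
  congr (_ * _); rewrite -(integral_ppow01 p0); apply: eq_integral => y _.
  have [y0|y0] := ltP 0%R y; last by rewrite (ppow_npos _ y0) !mul0e.
  rewrite ppowE// indicE mem_setE in_itv/= y0 /h powR_gt0//=; congr (_ * _%:E).
  have -> : (y `^ p < 1)%R = (y < 1)%R.
    have E1 : (1 `^ p = 1 :> R)%R by rewrite powR1.
    rewrite -[X in (_ < X)%R]E1.
    have [y1|y1] := ltP y 1%R.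
      by apply/(gt0_ltr_powR p0) => //; rewrite nnegrE ltW.
    by apply/negbTE; rewrite -leNgt; apply: (ge0_ler_powR (ltW p0)); rewrite ?nnegrE// ltW.
  by rewrite (ppowE _ y0); case: ifP; rewrite ?mulr1 ?mulr0.
apply: eq_integral => y _.
have [y0|y0] := ltP 0%R y; last first.
  rewrite (ppow_npos _ y0) !mul0e.
  by under eq_integral do rewrite mul0e mule0; rewrite integral0.
(* F (y^p / s) is F at the inverse of s / y^p *)
rewrite -(haar_scale (@powR_gt0 _ _ p y0) mF F0).
rewrite -(@haar_inv (fun s => F (y `^ p * s)%R)); last 2 first.
- by meas.
- by [].
rewrite -ge0_integralZl//; last 3 first.
- by meas.
- by move=> s _; rewrite mule_ge0// ppow_ge0E.
- by rewrite mule_ge0// ppow_ge0E.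
apply: eq_integral => s _; rewrite /G.
by rewrite [RHS]muleCA -muleA; congr (_ * (_ * _)); exact: muleC.
Qed.

Lemma integral_square (F : R -> \bar R) :
  measurable_fun setT F -> (forall x, 0 <= F x) ->
  \int[leb]_x ((ppow 1 x)%:E * F (x ^+ 2)%R) =
  (2^-1)%:E * \int[leb]_x ((ppow 0 x)%:E * F x).
Proof.
move=> mF F0.
have := @haar_pow 2 (fun x => (ppow 1 x)%:E * F x).
rewrite ltr0n => /(_ isT); rewrite -/(_ -> _).
have H1 : measurable_fun setT (fun x => (ppow 1 x)%:E * F x) by meas.
have H2 x : 0 <= (ppow 1 x)%:E * F x by rewrite mule_ge0 ?ppow_ge0E.
move=> /(_ H1 H2) H.
transitivity (\int[leb]_x ((ppow (-1) x)%:E * ((ppow 1 (x `^ 2))%:E * F (x `^ 2)%R))).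
  apply: eq_integral => x _.
  have [x0|x0] := ltP 0%R x; last by rewrite !(ppow_npos _ x0) !mul0e.
  rewrite muleA -EFinM -powR_mulrn ?ltW//; congr (_%:E * _).
  rewrite !ppowE ?powR_gt0// !powRr1 ?powR_ge0 ?ltW// -powRD.
    by rewrite (_ : -1 + 2 = 1)%R ?powRr1 ?ltW//; ring.
  by rewrite (gt_eqF x0) implybT.
rewrite H; congr (_ * _); apply: eq_integral => x _.
by rewrite muleA -EFinM ppowD addNr.
Qed.

End MultiplicativeHaar.

(** * Euler's Gamma and Beta integrals *)

Section GammaBeta.
Context {R : realType}.
Local Notation leb := (@lebesgue_measure R).
Local Open Scope ereal_scope.

(** Extended-real versions of Euler's integrals, so that Tonelli can be used
before finiteness is known. *)
Definition eGamma (s : R) : \bar R :=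
  \int[leb]_x (ppow (s - 1) x * expR (- x))%:E.

Definition eBeta (p q : R) : \bar R :=
  \int[leb]_v ((ppow (p - 1) v)%:E * (ppow (q - 1) (1 - v))%:E).

Lemma eGamma_ge0 s : 0 <= eGamma s.
Proof.
by apply: integral_ge0 => x _; rewrite lee_fin mulr_ge0 ?ppow_ge0 ?expR_ge0.
Qed.

Lemma eGamma1 : eGamma 1 = 1.
Proof.
rewrite /eGamma subrr -(@integral_exponential_pdf R 1%R ltr01).
transitivity (\int[leb]_(x in `]0%R, +oo[) (exponential_pdf 1 x)%:E).
  rewrite [RHS]integral_mkcond; apply: eq_integral => x _.
  rewrite /patch mem_setE in_itv/= andbT.
  have [x0|x0] := ltP 0%R x; last by rewrite ppow_npos// mul0r.
  by rewrite ppowE// exponential_pdfE ?ltW// powRr0 !mul1r mulN1r.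
rewrite integral_itv_obnd_cbnd; last first.
  apply/measurable_EFinP; apply: measurable_funTS.
  exact: measurable_exponential_pdf.
rewrite integral_mkcond; apply: eq_integral => x _.
rewrite /patch mem_setE in_itv/= andbT.
by case: leP => // x0; rewrite lt0_exponential_pdf.
Qed.

Lemma measurable_expRN : measurable_fun setT (fun x : R => expR (- x)%R).
Proof. by apply: measurableT_comp. Qed.

Lemma measurable_eGammaF s :
  measurable_fun setT (fun x : R => (ppow (s - 1) x * expR (- x))%:E).
Proof.
apply/measurable_EFinP; apply: measurable_funM; last exact: measurable_expRN.
exact: measurable_ppow.
Qed.

(** The substitution v -> x v extracts the homogeneity in x. *)
Lemma convolution_ppow (p q x : R) :
  \int[leb]_v ((ppow (p - 1) v)%:E * (ppow (q - 1) (x - v))%:E) =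
  (ppow (p + q - 1) x)%:E * eBeta p q.
Proof.
have [x0|x0] := ltP 0%R x; last first.
  rewrite (ppow_npos _ x0) mul0e; apply: integral0_eq => v _; have [v0|v0] := ltP 0%R v.
    by rewrite [X in _ * X%:E]ppow_npos ?mule0//; lra.
  by rewrite ppow_npos// mul0e.
have H := @ge0_integral_affine R x 0%R
  (fun v => (ppow (p - 1) v)%:E * (ppow (q - 1) (x - v))%:E).
rewrite gt_eqF// in H; move: (H isT) => {}H.
have xE : (ppow (p + q - 1) x = x * (x `^ (p - 1) * x `^ (q - 1)))%R.
  rewrite ppowE// -powRD ?(gt_eqF x0) ?implybT//.
  rewrite -[X in (X * _)%R](powRr1 (ltW x0)) -powRD ?(gt_eqF x0) ?implybT//.
  by congr (_ `^ _)%R; ring.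
rewrite xE EFinM -muleA -ge0_integralZl//; last 3 first.
- by meas.
- by move=> v _; rewrite mule_ge0// ppow_ge0E.
- by rewrite lee_fin mulr_ge0// powR_ge0.
transitivity (x%:E * ((`|x|^-1)%:E *
   \int[leb]_v ((ppow (p - 1) v)%:E * (ppow (q - 1) (x - v))%:E))).
  by rewrite muleA -EFinM gtr0_norm// divff ?gt_eqF// mul1e.
rewrite -H; last 2 first.
- by meas.
- by move=> v; rewrite mule_ge0// ppow_ge0E.
congr (_ * _); apply: eq_integral => v _.
rewrite addr0 -{2}(mulr1 x) -mulrBr !ppowMl// -!EFinM; congr _%:E; ring.
Qed.

Lemma ge0_integral_shift (c : R) (f : R -> \bar R) :
  measurable_fun setT f -> (forall x, 0 <= f x) ->
  \int[leb]_x f (x + c)%R = \int[leb]_x f x.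
Proof.
move=> mf f0.
have H := @ge0_integral_affine R 1 c f (oner_neq0 R) mf f0.
under eq_integral do rewrite -[X in (X + _)%R]mul1r.
by rewrite H normr1 invr1 mul1e.
Qed.

(** Write the product as a double integral in s and r = s + t and exchange the
order: the integral in s is a convolution of truncated powers at r. *)
Lemma eGammaM (p q : R) : eGamma p * eGamma q = eBeta p q * eGamma (p + q).
Proof.
have g0 s x : 0 <= (ppow (s - 1) x * expR (- x))%:E.
  by rewrite lee_fin mulr_ge0 ?ppow_ge0 ?expR_ge0.
have mg s := measurable_eGammaF s.
have mN := measurable_expRN.
have mp s := @measurable_ppow R s.
rewrite [eGamma p]/eGamma -ge0_integralZr//; last 2 first.
- exact: mg.
- exact: eGamma_ge0.
transitivity (\int[leb]_s \int[leb]_r (((ppow (p - 1) s)%:E *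
   (ppow (q - 1) (r - s))%:E) * (expR (- r))%:E)).
  apply: eq_integral => s _.
  rewrite /eGamma -(@ge0_integral_shift (- s)%R)// -ge0_integralZl//; last first.
    by meas.
  apply: eq_integral => r _.
  rewrite -!EFinM; congr _%:E.
  rewrite (_ : expR (- r) = expR (- s) * expR (- (r - s)))%R; last first.
    by rewrite -expRD; congr expR; ring.
  by ring.
rewrite tonelli; last 2 first.
- by meas.
- by move=> x y; rewrite !mule_ge0 ?ppow_ge0E ?lee_fin ?expR_ge0.
rewrite [RHS]muleC /eGamma -ge0_integralZr//; last 2 first.
- exact: measurable_eGammaF.
- by apply: integral_ge0 => v _; rewrite mule_ge0// ppow_ge0E.
apply: eq_integral => r _.
rewrite ge0_integralZr//; last 2 first.
- by meas.
- by move=> v _; rewrite mule_ge0// ppow_ge0E.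
by rewrite convolution_ppow EFinM -!muleA; congr (_ * _); exact: muleC.
Qed.

Lemma eBeta_r1 (p : R) : (0 < p)%R -> eBeta p 1 = (p^-1)%:E.
Proof.
move=> p0; rewrite -(integral_ppow01 p0); apply: eq_integral => v _.
have [v0|v0] := ltP 0%R v; last by rewrite !(ppow_npos _ v0) !mul0e.
rewrite -!EFinM mulrA ppowD subrr (addrC (-1)%R); congr (_ * _)%:E.
rewrite indicE mem_setE in_itv/= v0/= /ppow subr_gt0.
by case: ifP => // _; rewrite powRr0.
Qed.

(** The case q = 1 of the product formula, where the Beta integral is 1/s. *)
Lemma eGammaS (s : R) : (0 < s)%R -> eGamma (s + 1) = s%:E * eGamma s.
Proof.
move=> s0; have := eGammaM s 1.
rewrite eGamma1 mule1 eBeta_r1// => ->.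
by rewrite muleA -EFinM divff ?gt_eqF// mul1e.
Qed.

Lemma eGamma_nat (n : nat) : eGamma n.+1%:R = (n`!%:R)%:E.
Proof.
elim: n => [|n IH]; first by rewrite eGamma1.
by rewrite -natr1 eGammaS ?ltr0n// IH -EFinM -natrM factS.
Qed.

(** By the functional equation finiteness may be checked at s + 1, where the
integrand is at most the sum of those of Gamma(1) and Gamma(n+1), n >= s. *)
Lemma eGamma_lty (s : R) : (0 < s)%R -> eGamma s < +oo.
Proof.
move=> s0.
suff H : eGamma (s + 1) < +oo.
  move: H; rewrite eGammaS//; have := eGamma_ge0 s.
  by case: (eGamma s) => [r| |]//= _; rewrite ?ltry// gt0_muley.
have [n sn] : exists n : nat, (s <= n%:R)%R.
  by exists (Num.truncn s).+1; rewrite ltW// truncnS_gt.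
apply: (@le_lt_trans _ _ (eGamma 1 + eGamma n.+1%:R)); last first.
  by rewrite eGamma1 eGamma_nat -EFinD ltry.
have g0 t x : 0 <= (ppow (t - 1) x * expR (- x))%:E.
  by rewrite lee_fin mulr_ge0 ?ppow_ge0 ?expR_ge0.
have mg t := measurable_eGammaF t.
rewrite /eGamma -ge0_integralD//; [|exact: mg|exact: mg].
apply: ge0_le_integral => //.
- exact: mg.
- by apply: emeasurable_funD; exact: mg.
- move=> x _; rewrite -EFinD lee_fin -mulrDl ler_wpM2r ?expR_ge0//.
  rewrite addrK subrr -natr1 addrK.
  have [x0|x0] := ltP 0%R x; last by rewrite !ppow_npos// addr0.
  rewrite !ppowE// powRr0; have [x1|x1] := leP 1%R x.
    by rewrite (le_trans (ler_powR x1 sn))// lerDr.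
  apply: (@le_trans _ _ 1%R); last by rewrite lerDl powR_ge0.
  rewrite -(powRr0 x); apply: ger_powR; [by rewrite x0 ltW | exact: ltW].
Qed.

Lemma eGamma_gt0 (s : R) : (0 < s)%R -> 0 < eGamma s.
Proof.
move=> s0; apply: (@lt_le_trans _ _ ((expR (-1))%:E * (s^-1)%:E)).
  by rewrite -EFinM lte_fin mulr_gt0 ?expR_gt0 ?invr_gt0.
have m1 : measurable_fun setT
    (fun x : R => (ppow s x * \1_(`]0%R, 1%R[%classic : set R) x)%:E).
  by meas; exact: measurable_ppow.
have p0 x : 0 <= (ppow s x * \1_(`]0%R, 1%R[%classic : set R) x)%:E.
  by rewrite lee_fin mulr_ge0// ppow_ge0.
rewrite -(integral_ppow01 s0) -ge0_integralZl//; last 2 first.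
- by meas.
- by move=> x _; rewrite mule_ge0// ppow_ge0E.
apply: ge0_le_integral => //.
- by move=> x _; rewrite !mule_ge0 ?ppow_ge0E// lee_fin expR_ge0.
- by meas.
- exact: measurable_eGammaF.
- move=> x _; rewrite -!EFinM lee_fin [(ppow (-1) x * _)%R]mulrA ppowD.
  rewrite (addrC (-1)%R) mulrCA ler_wpM2l ?ppow_ge0//.
  rewrite indicE mem_setE in_itv/=; have [/andP[_ x1]|_] := boolP (_ && _); last first.
    by rewrite mulr0 expR_ge0.
  by rewrite mulr1 ler_expR; lra.
Qed.

Lemma eGammaE (s : R) : (0 < s)%R -> eGamma s = (Gamma s)%:E.
Proof.
move=> s0; rewrite -(@fineK _ (eGamma s)) ?ge0_fin_numE ?eGamma_ge0 ?eGamma_lty//.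
rewrite /Gamma /Rintegral integral_mkcond; congr (fine _)%:E.
apply: eq_integral => x _; rewrite /patch mem_setE in_itv/= andbT /ppow.
by case: ifP => // _; rewrite mul0r.
Qed.

Lemma Gamma_gt0 (s : R) : (0 < s)%R -> (0 < Gamma s)%R.
Proof. by move=> s0; rewrite -lte_fin -eGammaE// eGamma_gt0. Qed.

Lemma GammaS (s : R) : (0 < s)%R -> (Gamma (s + 1) = s * Gamma s)%R.
Proof.
move=> s0; apply: EFin_inj; rewrite EFinM -!eGammaE ?eGammaS// addr_gt0//.
Qed.

Lemma eBetaE (p q : R) : (0 < p)%R -> (0 < q)%R ->
  eBeta p q = (Gamma p * Gamma q / Gamma (p + q))%:E.
Proof.
move=> p0 q0; have pq0 : (0 < p + q)%R by rewrite addr_gt0.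
rewrite EFinM EFinM -!eGammaE// eGammaM eGammaE// -muleA -EFinM.
by rewrite divff ?mule1// gt_eqF// Gamma_gt0.
Qed.

End GammaBeta.
(* Keeps unification from unfolding the integral that defines Gamma. *)
Opaque Gamma.

(** * Composition of kernels and the Riemann-Liouville semigroup *)

Section KernelComposition.
Context {R : realType}.
Local Notation leb := (@lebesgue_measure R).
Local Open Scope ereal_scope.

Definition kcomp (A B : R -> R -> \bar R) (u w : R) : \bar R :=
  \int[leb]_v (A u v * B v w).

Definition nonneg_kernel (A : R -> R -> \bar R) :=
  measurable_fun setT (fun p : R * R => A p.1 p.2) /\ forall x y, 0 <= A x y.

Lemma nonneg_kernel_l A x : nonneg_kernel A -> measurable_fun setT (A x).
Proof.
case=> mA _.
exact: (measurableT_comp mA (measurable_pair1 x)).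
Qed.

Lemma nonneg_kernel_r A y : nonneg_kernel A -> measurable_fun setT (A ^~ y).
Proof.
case=> mA _.
exact: (measurableT_comp mA (measurable_pair2 y)).
Qed.

Lemma nonneg_kernel_comp d (T : measurableType d) A (f g : T -> R) :
  nonneg_kernel A -> measurable_fun setT f -> measurable_fun setT g ->
  measurable_fun setT (fun t => A (f t) (g t)).
Proof.
case=> mA _ mf mg.
have mfg : measurable_fun setT (fun t => (f t, g t)) by exact: measurable_fun_pair.
exact: (measurableT_comp mA mfg).
Qed.

Lemma nonneg_kernel_kcomp A B :
  nonneg_kernel A -> nonneg_kernel B -> nonneg_kernel (kcomp A B).
Proof.
move=> kA kB; have [mA A0] := kA; have [mB B0] := kB; split; last first.
  by move=> x y; apply: integral_ge0 => v _; exact: mule_ge0.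
apply: (@measurable_integral3 R (fun u w v => A u v * B v w)); last first.
  by move=> x y z; exact: mule_ge0.
apply: emeasurable_funM; apply: nonneg_kernel_comp => //; meas.
Qed.

Lemma kcompA A B C : nonneg_kernel A -> nonneg_kernel B -> nonneg_kernel C ->
  kcomp A (kcomp B C) = kcomp (kcomp A B) C.
Proof.
move=> kA kB kC; apply/funext => u; apply/funext => w.
have [[[mA A0] [mB B0]] [mC C0]] := (kA, kB, kC).
transitivity (\int[leb]_v \int[leb]_s (A u v * (B v s * C s w))).
  apply: eq_integral => v _; rewrite ge0_integralZl//.
  - apply: emeasurable_funM; first exact: nonneg_kernel_l.
    exact: nonneg_kernel_r.
  - by move=> s _; exact: mule_ge0.
rewrite tonelli; last 2 first.
- apply: emeasurable_funM; last apply: emeasurable_funM;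
    apply: nonneg_kernel_comp => //; meas.
- by move=> v s; rewrite !mule_ge0.
apply: eq_integral => s _.
rewrite /kcomp -ge0_integralZr//; last 2 first.
- apply: emeasurable_funM; first exact: nonneg_kernel_l.
  exact: nonneg_kernel_r.
- by move=> v _; exact: mule_ge0.
by apply: eq_integral => v _; rewrite muleA.
Qed.

(** The kernel of the operator u^a W^p v^b, where W^p is the Weyl fractional
integral of order p, restricted to the positive half-line. *)
Definition riesz (a p b u v : R) : \bar R :=
  (ppow a u * ppow (p - 1) (v - u) * ppow b v / Gamma p)%:E.

Lemma nonneg_kernel_riesz a p b : (0 < p)%R -> nonneg_kernel (riesz a p b).
Proof.
move=> p0; split; last first.
  move=> x y; rewrite lee_fin !mulr_ge0 ?ppow_ge0// invr_ge0 ltW//.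
  exact: Gamma_gt0.
have mp (s : R) := @measurable_ppow R s.
by rewrite /riesz; meas.
Qed.

Lemma riesz0 a p b u v : ~~ (0 < u < v)%R -> riesz a p b u v = 0.
Proof.
rewrite /riesz; have [u0|u0] := ltP 0%R u; last by rewrite ppow_npos// !mul0r.
by rewrite /= -leNgt => uv; rewrite (@ppow_npos _ _ (v - u)%R) ?mulr0 ?mul0r ?subr_le0.
Qed.

Lemma kcomp_riesz0 a p b b' q c u w : ~~ (0 < u < w)%R ->
  kcomp (riesz a p b) (riesz b' q c) u w = 0.
Proof.
move=> uw; apply: integral0_eq => v _.
have [uv|uv] := boolP (0 < u < v)%R; last by rewrite riesz0// mul0e.
rewrite [X in _ * X]riesz0 ?mule0//; apply: contra uw => /andP[v0 vw].
by case/andP: uv => -> uv; rewrite (lt_trans uv).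
Qed.

Lemma kcomp_riesz_shift a p b b' q c :
  kcomp (riesz a p b) (riesz b' q c) = kcomp (riesz a p (b + b')%R) (riesz 0 q c).
Proof.
apply/funext => u; apply/funext => w; apply: eq_integral => v _.
rewrite -!EFinM; congr _%:E.
rewrite -{1}[b']addr0 -!ppowD; ring.
Qed.

(** The semigroup law of the Weyl fractional integrals: the Beta integral
cancels the normalizations by Gamma. *)
Lemma kcomp_riesz a p q c : (0 < p)%R -> (0 < q)%R ->
  kcomp (riesz a p 0) (riesz 0 q c) = riesz a (p + q)%R c.
Proof.
move=> p0 q0; apply/funext => u; apply/funext => w.
have [uw|uw] := boolP (0 < u < w)%R; last by rewrite kcomp_riesz0// riesz0.
have [u0 {}uw] := andP uw.
have pq0 : (0 < p + q)%R by rewrite addr_gt0.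
pose f v : \bar R := (ppow (p - 1) (v - u))%:E * (ppow (q - 1) (w - v))%:E.
have f0 v : 0 <= f v by rewrite mule_ge0// ppow_ge0E.
have mf : measurable_fun setT f.
  have mp (s : R) := @measurable_ppow R s.
  by rewrite /f; meas.
pose c0 := (ppow a u * ppow c w / (Gamma p * Gamma q))%R.
have [[gp gq] gpq] := (Gamma_gt0 p0, Gamma_gt0 q0, Gamma_gt0 pq0).
transitivity (\int[leb]_v (c0%:E * f v)).
  apply: eq_integral => v _; rewrite -!EFinM; congr _%:E.
  have [uv|uv] := ltP u v; last first.
    by rewrite (@ppow_npos _ _ (v - u)%R) ?subr_le0// !(mulr0,mul0r).
  rewrite !(ppowE 0) ?(lt_trans u0)// !powRr0 /c0; field.
  by rewrite (gt_eqF gp) (gt_eqF gq).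
rewrite ge0_integralZl//; last first.
  rewrite lee_fin; apply: divr_ge0; last exact: mulr_ge0 (ltW gp) (ltW gq).
  by apply: mulr_ge0; exact: ppow_ge0.
rewrite -(@ge0_integral_shift _ u)// /f.
under eq_integral => v _ do rewrite addrK opprD addrA addrAC.
rewrite convolution_ppow eBetaE// -!EFinM; congr _%:E; rewrite /c0; field.
by rewrite ?(gt_eqF gp) ?(gt_eqF gq) ?(gt_eqF gpq).
Qed.

End KernelComposition.

(** * The Bessel kernel and its semigroup law *)

Section BesselKernelAlgebra.
Context {R : realType}.
Local Notation leb := (@lebesgue_measure R).
Local Open Scope ereal_scope.

Lemma powRE (x p : R) : (0 < x)%R -> (x `^ p = expR (p * ln x))%R.
Proof. by move=> x0; rewrite /powR gt_eqF. Qed.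

(** The substitution x -> r/x, which preserves dx/x. *)
Lemma integral_haar_invl (r : R) (F : R -> \bar R) : (0 < r)%R ->
  measurable_fun setT F -> (forall x, 0 <= F x) ->
  \int[leb]_x ((ppow (-1) x)%:E * F x) =
  \int[leb]_x ((ppow (-1) x)%:E * F (r * x `^ (-1))%R).
Proof.
move=> r0 mF F0; rewrite -(haar_scale r0 mF F0).
rewrite -(@haar_inv _ (fun x => F (r * x)%R))//.
by meas.
Qed.

(** The commutation u^(-p-mu) W^p v^mu W^q w^(-q-mu) = W^q v^(-p-q-mu) W^p.
For fixed u < w the substitution v -> uw/v is an involution of ]u, w[ that
exchanges the roles of v - u and w - v, hence those of p and q. *)
Lemma riesz_inversion (mu p q : R) : (0 < p)%R -> (0 < q)%R ->
  kcomp (riesz (- p - mu) p mu) (riesz 0 q (- q - mu)) =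
  kcomp (riesz 0 q (- p - q - mu)) (riesz 0 p 0).
Proof.
move=> p0 q0; apply/funext => u; apply/funext => w.
have [/andP[u0 uw]|uw] := boolP (0 < u < w)%R; last by rewrite !kcomp_riesz0.
have w0 : (0 < w)%R by exact: lt_trans uw.
pose c0 := (u `^ (- p - mu) * w `^ (- q - mu) / (Gamma p * Gamma q))%R.
pose F v : \bar R := (c0 * ppow (mu + 1) v *
   (ppow (p - 1) (v - u) * ppow (q - 1) (w - v)))%:E.
have [gp gq] := (Gamma_gt0 p0, Gamma_gt0 q0).
have F0 v : 0 <= F v.
  rewrite lee_fin !mulr_ge0 ?ppow_ge0// ?powR_ge0//.
  by rewrite invr_ge0 mulr_ge0 ?ltW.
have mF : measurable_fun setT F.
  have mp (s : R) := @measurable_ppow R s.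
  by rewrite /F; meas.
transitivity (\int[leb]_v ((ppow (-1) v)%:E * F v)).
  apply: eq_integral => v _; rewrite -!EFinM; congr _%:E.
  have [v0|v0] := ltP 0%R v; last by rewrite !(ppow_npos _ v0) !(mulr0,mul0r).
  rewrite !(ppowE _ v0) !(ppowE _ u0) !(ppowE _ w0) powRr0 /c0.
  rewrite [(v `^ (mu + 1))%R]powRD ?(gt_eqF v0) ?implybT// powRr1 ?ltW//.
  rewrite powR_inv1 ?ltW//; field.
  by rewrite (gt_eqF gp) (gt_eqF gq) (gt_eqF v0).
rewrite (@integral_haar_invl (u * w)%R _ (mulr_gt0 u0 w0) mF F0).
apply: eq_integral => v _; rewrite -!EFinM; congr _%:E.
have [v0|v0] := ltP 0%R v; last first.
  by rewrite !(ppow_npos _ v0) !(mulr0,mul0r).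
rewrite powR_inv1 ?ltW//.
rewrite (_ : u * w / v - u = (u / v) * (w - v))%R; last by field; rewrite gt_eqF.
rewrite (_ : w - u * w / v = (w / v) * (v - u))%R; last by field; rewrite gt_eqF.
have uv0 : (0 < u / v)%R by rewrite divr_gt0.
have wv0 : (0 < w / v)%R by rewrite divr_gt0.
have uw0 : (0 < u * w)%R by rewrite mulr_gt0.
rewrite !ppowMl//; set X := ppow (p - 1) (w - v); set Y := ppow (q - 1) (v - u).
rewrite !ppowE ?invr_gt0 ?mulr_gt0// /c0 !powRr0.
transitivity ((v `^ (-1) * u `^ (- p - mu) * w `^ (- q - mu) *
   ((u * w) `^ (mu + 1) * v^-1 `^ (mu + 1)) * (u / v) `^ (p - 1) * (w / v) `^ (q - 1)) *
   (X * Y / (Gamma p * Gamma q)))%R; first by ring.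
rewrite [X in (X * _)%R](_ : _ = v `^ (- p - q - mu))%R; last first.
  rewrite !powRE ?invr_gt0 ?divr_gt0 ?mulr_gt0// !lnM ?posrE ?invr_gt0 ?mulr_gt0//.
  by rewrite !lnV ?posrE// -!expRD; congr expR; ring.
by field; rewrite (gt_eqF gp) (gt_eqF gq).
Qed.

(** The kernel of W^g v^(-g-mu) W^g w^mu: up to the factor 4^(-g), the
Bessel operator to the power -g in the variable x^2. *)
Definition bessel_core (mu g : R) := kcomp (riesz 0 g (- g - mu)) (riesz 0 g mu).

(* The composition identities are matched syntactically; unfolding the kernels
   to compare them would be very slow. *)
Opaque kcomp riesz.
(** Grouping the four Weyl integrals of the product so that the two middle ones
meet, riesz_inversion exchanges them, and equal neighbours then merge. *)
Lemma bessel_core_semigroup (mu a b : R) : (0 < a)%R -> (0 < b)%R ->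
  kcomp (bessel_core mu a) (bessel_core mu b) = bessel_core mu (a + b).
Proof.
move=> a0 b0; rewrite /bessel_core.
have kr x y c := @nonneg_kernel_riesz R x c y.
have kk A B := @nonneg_kernel_kcomp R A B.
rewrite (_ : kcomp (riesz 0 a (- a - mu)) (riesz 0 a mu) =
    kcomp (riesz 0 a 0) (riesz (- a - mu) a mu)); last first.
  by rewrite [RHS]kcomp_riesz_shift add0r [LHS]kcomp_riesz_shift addr0.
rewrite -kcompA; [|exact: kr|exact: kr|by apply: kk; exact: kr].
rewrite [X in kcomp _ X]kcompA; [|exact: kr..].
rewrite riesz_inversion//.
rewrite -[X in kcomp _ X]kcompA; [|exact: kr..].
rewrite kcompA; [|exact: kr|exact: kr|by apply: kk; exact: kr].
have -> : kcomp (riesz 0 a 0) (riesz 0 b (- a - b - mu)) =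
    riesz 0 (a + b) (- (a + b) - mu).
  by rewrite kcomp_riesz// opprD.
by have -> : kcomp (riesz 0 a 0) (riesz 0 b mu) = riesz 0 (a + b) mu
  by exact: kcomp_riesz.
Qed.

Transparent kcomp riesz.
Lemma nonneg_kernel_bessel_core (mu g : R) : (0 < g)%R ->
  nonneg_kernel (bessel_core mu g).
Proof. by move=> g0; apply: nonneg_kernel_kcomp; exact: nonneg_kernel_riesz. Qed.

Lemma bessel_core0 (mu g u w : R) : ~~ (0 < u < w)%R -> bessel_core mu g u w = 0.
Proof. exact: kcomp_riesz0. Qed.

(** The core kernel written in x = sqrt u and z = sqrt w, with dw = 2 z dz. *)
Definition bessel_kernel (nu g x z : R) : \bar R :=
  (2 * 4 `^ (- g) * ppow 0 x * ppow 1 z)%:E *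
  bessel_core ((nu - 1) / 2) g (x ^+ 2) (z ^+ 2).

Lemma nonneg_kernel_bessel (nu g : R) : (0 < g)%R ->
  nonneg_kernel (bessel_kernel nu g).
Proof.
move=> g0; have kc := @nonneg_kernel_bessel_core ((nu - 1) / 2) g g0.
split; last first.
  move=> x z; rewrite mule_ge0 ?kc.2// lee_fin.
  by rewrite !mulr_ge0 ?ppow_ge0 ?powR_ge0.
apply: emeasurable_funM.
  have mp (s : R) := @measurable_ppow R s.
  by meas.
by apply: nonneg_kernel_comp => //; rewrite /=; apply: measurable_funX; meas.
Qed.

Lemma bessel_kernel0 (nu g x z : R) : ~~ (0 < x < z)%R -> bessel_kernel nu g x z = 0.
Proof.
rewrite /bessel_kernel.
have [x0|x0] := ltP 0%R x; last by rewrite (ppow_npos _ x0) mulr0 mul0r mul0e.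
have [z0|z0] := ltP 0%R z; last by rewrite (ppow_npos _ z0) mulr0 mul0e.
move=> xz; rewrite bessel_core0 ?mule0//; apply: contra xz => /andP[_].
by rewrite ltr_pXn2r// ?nnegrE ltW.
Qed.

Lemma bessel_kernel_semigroup (nu a b x z : R) : (0 < a)%R -> (0 < b)%R ->
  \int[leb]_y (bessel_kernel nu a x y * bessel_kernel nu b y z) =
  bessel_kernel nu (a + b) x z.
Proof.
move=> a0 b0; set mu := ((nu - 1) / 2)%R.
have ka := @nonneg_kernel_bessel_core mu a a0.
have kb := @nonneg_kernel_bessel_core mu b b0.
pose F v := bessel_core mu a (x ^+ 2) v * bessel_core mu b v (z ^+ 2).
have mF : measurable_fun setT F.
  apply: emeasurable_funM; first exact: nonneg_kernel_l.
  exact: nonneg_kernel_r.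
have F0 v : 0 <= F v by apply: mule_ge0; [exact: ka.2|exact: kb.2].
pose c0 := (2 * 4 `^ (- a) * ppow 0 x * (2 * 4 `^ (- b) * ppow 1 z))%R.
have c00 : (0 <= c0)%R by rewrite !mulr_ge0 ?powR_ge0 ?ppow_ge0.
transitivity (\int[leb]_y (c0%:E * ((ppow 1 y)%:E * F (y ^+ 2)%R))).
  apply: eq_integral => y _; rewrite /bessel_kernel /F -/mu.
  rewrite muleACA [RHS]muleA -!EFinM; congr (_%:E * _).
  have [y0|y0] := ltP 0%R y; last by rewrite !(ppow_npos _ y0) !(mulr0,mul0r).
  by rewrite !(ppowE _ y0) powRr0 /c0; ring.
rewrite ge0_integralZl//; last 2 first.
- apply: emeasurable_funM; first by meas.
  by apply: (measurableT_comp mF); exact: measurable_funX.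
- by move=> y _; rewrite mule_ge0 ?ppow_ge0E.
rewrite integral_square//.
rewrite (_ : \int[leb]_v _ = bessel_core mu (a + b) (x ^+ 2) (z ^+ 2)); last first.
  rewrite -bessel_core_semigroup//; apply: eq_integral => v _; rewrite /F.
  have [v0|v0] := ltP 0%R v; first by rewrite ppowE// powRr0 mul1e.
  by rewrite ppow_npos// mul0e [X in _ * X]bessel_core0 ?mule0// ltNge v0.
rewrite /bessel_kernel -/mu muleA -EFinM; congr (_%:E * _); rewrite /c0.
by rewrite opprD powRD ?pnatr_eq0 ?implybT//; field.
Qed.

End BesselKernelAlgebra.

(** * Binomial series and Euler's integral for the Gauss series *)

Section EulerIntegral.
Context {R : realType}.
Local Notation leb := (@lebesgue_measure R).

Lemma ppowX (p : R) (n : nat) (x : R) : ppow p x * x ^+ n = ppow (p + n%:R) x.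
Proof.
have [x0|x0] := ltP 0 x; last by rewrite !ppow_npos// mul0r.
by rewrite !ppowE// -powR_mulrn ?ltW// -powRD// (gt_eqF x0) implybT.
Qed.

Lemma risingS (a : R) n : rising a n.+1 = rising a n * (a + n%:R).
Proof. by rewrite /rising big_ord_recr. Qed.

Lemma rising_shift (a : R) n : rising a n.+1 = a * rising (a + 1) n.
Proof.
rewrite /rising big_ord_recl addr0; congr (_ * _); apply: eq_bigr => i _.
by rewrite lift0 -natr1 -addrA [1 + _]addrC.
Qed.

Lemma rising_gt0 (a : R) n : 0 < a -> 0 < rising a n.
Proof. by move=> a0; apply: prodr_gt0 => i _; rewrite ltr_wpDr. Qed.

Lemma Gamma_rising (a : R) n : 0 < a -> Gamma (a + n%:R) = rising a n * Gamma a.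
Proof.
move=> a0; elim: n => [|n IH]; first by rewrite addr0 /rising big_ord0 mul1r.
have an0 : 0 < a + n%:R by rewrite ltr_wpDr.
by rewrite -natr1 addrA (GammaS an0) IH risingS mulrA [_ * rising a n]mulrC.
Qed.

Lemma dominated_cvg_pointwise (f_ : nat -> R -> \bar R) (f g : R -> \bar R) :
  (forall n, measurable_fun setT (f_ n)) ->
  (forall s, f_ ^~ s @ \oo --> f s) ->
  leb.-integrable setT g -> (forall n s, `|f_ n s| <= g s)%E ->
  leb.-integrable setT f /\
  (fun n => \int[leb]_s f_ n s)%E @ \oo --> (\int[leb]_s f s)%E.
Proof.
move=> mf_ f_f ig f_le.
have mf : measurable_fun setT f.
  by apply: (emeasurable_fun_cvg f_) => [n|s _]; [exact: mf_|exact: f_f].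
have D1 : {ae leb, forall s, [set: measurableTypeR R] s -> f_ ^~ s @ \oo --> f s}.
  by apply: aeW => s _; exact: f_f.
have D2 : {ae leb, forall s n, [set: measurableTypeR R] s -> `|f_ n s| <= g s}%E.
  by apply: aeW => s n _; exact: f_le.
by have [] := @dominated_convergence _ _ _ leb _ measurableT f_ f g mf_ mf D1 ig D2.
Qed.

(** The coefficient of x^n in (1 - x)^(-a). *)
Definition binomial_coef (a : R) (n : nat) : R := rising a n / n`!%:R.

Lemma binomial_coefS (a : R) n :
  binomial_coef a n.+1 = binomial_coef (a + 1) n.+1 - binomial_coef (a + 1) n.
Proof.
rewrite /binomial_coef rising_shift (risingS (a + 1)) factS natrM -natr1.
have n0 : n`!%:R != 0 :> R by rewrite pnatr_eq0 -lt0n fact_gt0.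
have n1 : n%:R + 1 != 0 :> R by rewrite natr1 pnatr_eq0.
by field; rewrite n0 n1.
Qed.

(** Expand exp(x s) in int s^(a-1) exp(-(1-x) s) ds = (1-x)^(-a) Gamma(a) and
integrate termwise; for a > 0 all terms are nonnegative. *)
Lemma binomial_series_pos (a x : R) : 0 < a -> 0 <= x < 1 ->
  series (fun n => binomial_coef a n * x ^+ n) @ \oo --> (1 - x) `^ (- a).
Proof.
move=> a0 /andP[x0 x1].
pose G s := ppow (a - 1) s * expR (- s).
have G0 s : 0 <= G s by rewrite mulr_ge0 ?ppow_ge0 ?expR_ge0.
have mG : measurable_fun setT G.
  apply: measurable_funM; first exact: measurable_ppow.
  exact: measurable_expRN.
pose f_ N s := (G s * series (exp_coeff (x * s)) N)%:E.
pose f s := (G s * expR (x * s))%:E.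
have mf : measurable_fun setT f.
  by apply/measurable_EFinP; apply: measurable_funM => //; meas.
have f0 s : (0 <= f s)%E by rewrite lee_fin mulr_ge0 ?expR_ge0.
have If : (\int[leb]_s f s = ((1 - x) `^ (- a) * Gamma a)%:E)%E.
  have x1' : 0 < 1 - x by lra.
  have H := @ge0_integral_affine R (1 - x) 0 (fun s => (G s)%:E).
  have mGE : measurable_fun setT (fun s => (G s)%:E) by exact/measurable_EFinP.
  rewrite gt_eqF// in H; have {}H := H isT mGE (fun s => G0 s).
  rewrite -[X in (_ * X)%E]/(eGamma a) eGammaE// gtr0_norm// in H.
  transitivity (((1 - x) `^ (1 - a))%:E * \int[leb]_s (G ((1 - x) * s + 0))%:E)%E.
    rewrite -ge0_integralZl; [|exact: measurableT| | |]; last 3 first.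
    - apply/measurable_EFinP; apply: (measurableT_comp mG) => //.
      by apply: measurable_funD => //; apply: measurable_funM.
    - by move=> s _; rewrite lee_fin.
    - by rewrite lee_fin powR_ge0.
    apply: eq_integral => s _; rewrite /f /G addr0 -EFinM ppowMl//.
    rewrite !mulrA -powRD ?(gt_eqF x1') ?implybT//.
    rewrite (_ : 1 - a + (a - 1) = 0); last by ring.
    rewrite powRr0 mul1r -mulrA -expRD; congr (_ * expR _)%:E; ring.
  rewrite H muleA -!EFinM -(powR_inv1 (ltW x1')) -powRD; last first.
    by rewrite (gt_eqF x1') implybT.
  by congr (_ `^ _ * _)%:E; ring.
have mf_ N : measurable_fun setT (f_ N).
  apply/measurable_EFinP; apply: measurable_funM => //.
  rewrite /series/=; apply: measurable_sum => n.
  apply: measurable_funM => //; apply: measurable_funX.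
  exact: measurable_funM.
have f_f s : f_ ^~ s @ \oo --> f s.
  apply: cvg_EFin; first by near=> n.
  apply: cvgM; first exact: cvg_cst.
  exact: is_cvg_series_exp_coeff.
have f_le N s : (`|f_ N s| <= f s)%E.
  rewrite abse_EFin lee_fin.
  have [s0|s0] := ltP 0 s; last by rewrite /G ppow_npos// !mul0r normr0.
  have e0 n : 0 <= exp_coeff (x * s) n.
    by rewrite /exp_coeff/= mulr_ge0// exprn_ge0// mulr_ge0// ltW.
  rewrite ger0_norm; last by rewrite mulr_ge0// sumr_ge0.
  rewrite ler_wpM2l//; apply: nondecreasing_cvgn_le; last first.
    exact: is_cvg_series_exp_coeff.
  by apply: nondecreasing_series => n _ _; exact: e0.
have intf : leb.-integrable setT f.
  apply/integrableP; split => //.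
  under eq_integral do rewrite gee0_abs//.
  by rewrite If ltry.
have [_] := dominated_cvg_pointwise mf_ f_f intf f_le; rewrite If => H.
have If_ N : (\int[leb]_s f_ N s =
    (series (fun n => binomial_coef a n * x ^+ n) N * Gamma a)%:E)%E.
  transitivity (\int[leb]_s (\sum_(0 <= n < N) (x ^+ n / n`!%:R)%:E *
      (ppow (a + n%:R - 1) s * expR (- s))%:E))%E.
    apply: eq_integral => s _; rewrite /f_ /series/= mulr_sumr -sumEFin.
    apply: eq_bigr => n _; rewrite -EFinM /G /exp_coeff/= exprMn.
    rewrite (_ : a + n%:R - 1 = a - 1 + n%:R); last by ring.
    by rewrite -ppowX; congr _%:E; ring.
  rewrite ge0_integral_sum; [|exact: measurableT| |]; last 2 first.
  - move=> n; apply: emeasurable_funM => //; exact: measurable_eGammaF.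
  - move=> n s _; rewrite mule_ge0// lee_fin ?mulr_ge0 ?ppow_ge0 ?expR_ge0//.
    exact: exprn_ge0.
  rewrite /series/= mulr_suml -sumEFin; apply: eq_bigr => n _.
  rewrite ge0_integralZl; [|exact: measurableT| | |]; last 3 first.
  - exact: measurable_eGammaF.
  - by move=> s _; rewrite lee_fin mulr_ge0 ?ppow_ge0 ?expR_ge0.
  - by rewrite lee_fin mulr_ge0// exprn_ge0.
  have an0 : 0 < a + n%:R by rewrite ltr_wpDr.
  rewrite -/(eGamma _) (eGammaE an0) (Gamma_rising n a0) -EFinM.
  by congr _%:E; rewrite /binomial_coef; ring.
pose S := series (fun n => binomial_coef a n * x ^+ n).
have {}H : (fun N => (S N * Gamma a)%:E) @ \oo --> ((1 - x) `^ (- a) * Gamma a)%:E.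
  rewrite [X in X @ _ --> _](_ : _ = (fun N => \int[leb]_s f_ N s)%E) //.
  by apply/funext => N; rewrite If_.
have ga := Gamma_gt0 a0.
have : (fun N => S N * Gamma a * (Gamma a)^-1) @ \oo -->
    (1 - x) `^ (- a) * Gamma a * (Gamma a)^-1.
  by apply: cvgM; [exact: (fine_cvg H)|exact: cvg_cst].
by under eq_fun do rewrite (mulfK (lt0r_neq0 ga)); rewrite (mulfK (lt0r_neq0 ga)).
Unshelve. all: by end_near. Qed.

(** Multiplying the series of exponent a + 1 by 1 - x gives that of exponent a,
by the recurrence of the coefficients; this reaches all a > -1. *)
Lemma binomial_series (a x : R) : -1 < a -> 0 <= x < 1 ->
  series (fun n => binomial_coef a n * x ^+ n) @ \oo --> (1 - x) `^ (- a).
Proof.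
move=> a1 x01; have a10 : 0 < a + 1 by lra.
have [x0 x1] := andP x01.
pose S b := series (fun n => binomial_coef b n * x ^+ n).
have H := binomial_series_pos a10 x01.
have E N : S a N.+1 = S (a + 1) N.+1 - x * S (a + 1) N.
  rewrite /S /series/=; elim: N => [|N IH].
    rewrite !big_nat1 big_geq// mulr0 subr0 /binomial_coef /rising !big_ord0.
    by [].
  rewrite big_nat_recr//= IH [in RHS]big_nat_recr//=.
  rewrite [X in _ = _ - x * X]big_nat_recr//= binomial_coefS exprS; ring.
have H1 : [sequence S (a + 1) N.+1]_N @ \oo --> (1 - x) `^ (- (a + 1)).
  by rewrite cvg_shiftS.
rewrite -cvg_shiftS [X in X @ _ --> _](_ : _ =
    (fun N => S (a + 1) N.+1 - x * S (a + 1) N)); last exact/funext.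
have -> : (1 - x) `^ (- a) = (1 - x) `^ (- (a + 1)) - x * (1 - x) `^ (- (a + 1)).
  have x1' : 0 < 1 - x by lra.
  transitivity ((1 - x) `^ 1 * (1 - x) `^ (- (a + 1))).
    by rewrite -powRD ?(gt_eqF x1') ?implybT//; congr (_ `^ _); ring.
  by rewrite (powRr1 (ltW x1')) mulrBl mul1r.
by apply: cvgB => //; apply: cvgMr.
Qed.

Lemma le_norm_rising (a : R) n : `|rising a n| <= rising (`|a| + 1) n.
Proof.
rewrite /rising normr_prod; apply: ler_prod => i _; rewrite normr_ge0/=.
rewrite (le_trans (ler_normD _ _))// normr_nat; lra.
Qed.

(** Integrate the binomial series of (1 - t s)^(-a) termwise against the Beta
weight. The coefficients may change sign when a < 0, so this is dominated
convergence: the partial sums are bounded by the series of exponent |a| + 1 at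
t < 1. *)
Lemma euler_integral (a b d t : R) : -1 < a -> 0 < b -> 0 < d -> 0 <= t < 1 ->
  (\int[leb]_s (ppow (b - 1) s * ppow (d - 1) (1 - s) * (1 - t * s) `^ (- a))%:E =
   (hyp2F1 a b (b + d) t * (Gamma b * Gamma d / Gamma (b + d)))%:E)%E.
Proof.
move=> a1 b0 d0 t01; have [t0 t1] := andP t01.
have bd0 : 0 < b + d by rewrite addr_gt0.
set Be := Gamma b * Gamma d / Gamma (b + d).
pose w s := ppow (b - 1) s * ppow (d - 1) (1 - s).
have w0 s : 0 <= w s by rewrite mulr_ge0 ?ppow_ge0.
have mp (p : R) := measurable_ppow p.
have mw : measurable_fun setT w by rewrite /w; meas.
have wE s : w s != 0 -> 0 < s < 1.
  apply: contraNT; rewrite negb_and -!leNgt => /orP[h|h]; apply/eqP.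
    by rewrite /w ppow_npos// mul0r.
  by rewrite /w [X in _ * X]ppow_npos ?mulr0// subr_le0.
pose M := (1 - t) `^ (- (`|a| + 1)).
pose S N x := series (fun n => binomial_coef a n * x ^+ n) N.
pose f_ N s := (w s * S N (t * s))%:E.
pose f s := (w s * (1 - t * s) `^ (- a))%:E.
pose g s := (w s * M)%:E.
have mf_ N : measurable_fun setT (f_ N).
  apply/measurable_EFinP; apply: measurable_funM => //.
  rewrite /S /series/=; apply: measurable_sum => n.
  apply: measurable_funM => //; apply: measurable_funX.
  exact: measurable_funM.
have f_f s : f_ ^~ s @ \oo --> f s.
  apply: cvg_EFin; first by near=> n.
  have [ws|/wE/andP[s0 s1]] := eqVneq (w s) 0.
    rewrite ws mul0r (_ : fine \o f_ ^~ s = cst 0); first exact: cvg_cst.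
    by apply/funext => n /=; rewrite ws mul0r.
  apply: cvgM; first exact: cvg_cst.
  apply: binomial_series => //.
  have ts0 : 0 <= t * s by rewrite mulr_ge0// ltW.
  by rewrite ts0/= (le_lt_trans _ t1)// ler_piMr// ltW.
have mg : measurable_fun setT g.
  by apply/measurable_EFinP; apply: measurable_funM.
have Iw n : (\int[leb]_s (w s * s ^+ n)%:E =
    (rising b n / rising (b + d) n * Be)%:E)%E.
  transitivity (eBeta (b + n%:R) d).
    apply: eq_integral => s _; rewrite -EFinM /w.
    rewrite (_ : b + n%:R - 1 = b - 1 + n%:R); last by ring.
    by rewrite -ppowX; congr _%:E; ring.
  have bn0 : 0 < b + n%:R by rewrite ltr_wpDr.
  rewrite (eBetaE bn0 d0) addrAC (Gamma_rising n b0) (Gamma_rising n bd0).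
  congr _%:E; rewrite /Be.
  have := rising_gt0 n bd0; have := Gamma_gt0 bd0.
  move: (Gamma b) (Gamma d) (Gamma (b + d)) (rising (b + d) n) (rising b n) => x1 x2 x3 x4 x5 h1 h2.
  by field; rewrite !gt_eqF.
have ig : leb.-integrable setT g.
  apply/integrableP; split => //.
  have g0 s : (0 <= g s)%E by rewrite lee_fin mulr_ge0 ?powR_ge0.
  under eq_integral do rewrite (gee0_abs (g0 _)).
  have -> : (\int[leb]_s g s = M%:E * \int[leb]_s (w s * s ^+ 0)%:E)%E.
    rewrite -ge0_integralZl; [|exact: measurableT| | |]; last 3 first.
    - by apply/measurable_EFinP; under eq_fun do rewrite expr0 mulr1.
    - by move=> s _; rewrite expr0 mulr1 lee_fin.
    - by rewrite lee_fin powR_ge0.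
    by apply: eq_integral => s _; rewrite -EFinM expr0 mulr1 mulrC.
  by rewrite Iw -EFinM ltry.
have f_le N s : (`|f_ N s| <= g s)%E.
  rewrite abse_EFin lee_fin.
  have [ws|/wE/andP[s0 s1]] := eqVneq (w s) 0; first by rewrite ws !mul0r normr0.
  rewrite normrM (ger0_norm (w0 s)) ler_wpM2l//.
  pose u n := binomial_coef (`|a| + 1) n * t ^+ n.
  have a10 : 0 < `|a| + 1 by rewrite ltr_wpDl.
  have u0 n : 0 <= u n.
    by rewrite !mulr_ge0 ?invr_ge0 ?exprn_ge0// ltW// rising_gt0.
  have cu := binomial_series_pos a10 t01.
  apply: (@le_trans _ _ (series u N)); last first.
    rewrite /M -(cvg_lim _ cu)//; apply: nondecreasing_cvgn_le.
      by apply: nondecreasing_series => n _ _; exact: u0.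
    by apply/cvg_ex; eexists; exact: cu.
  rewrite /S /series/= (le_trans (ler_norm_sum _ _ _))//; apply: ler_sum => n _.
  rewrite /u /binomial_coef normrM normrX normf_div normr_nat.
  apply: ler_pM; rewrite ?mulr_ge0 ?invr_ge0 ?exprn_ge0//.
    by rewrite ler_wpM2r ?invr_ge0// le_norm_rising.
  have ts0 : 0 <= t * s by rewrite mulr_ge0// ltW.
  rewrite ger0_norm// lerXn2r ?nnegrE//.
  by rewrite ler_piMr// ltW.
have If_ N : (\int[leb]_s f_ N s =
    (series (fun n => rising a n * rising b n / (rising (b + d) n * n`!%:R) * t ^+ n) N
      * Be)%:E)%E.
  have iw n : leb.-integrable setT (fun s => (w s * s ^+ n)%:E)%E.
    apply/integrableP; split.
      by apply/measurable_EFinP; apply: measurable_funM => //; exact: measurable_funX.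
    have wn0 s : (0 <= (w s * s ^+ n)%:E)%E.
      have [ws|/wE/andP[s0 s1]] := eqVneq (w s) 0; first by rewrite ws mul0r.
      by rewrite lee_fin mulr_ge0// exprn_ge0// ltW.
    under eq_integral do rewrite (gee0_abs (wn0 _)).
    by rewrite Iw ltry.
  transitivity (\int[leb]_s (\sum_(0 <= n < N)
      ((binomial_coef a n * t ^+ n)%:E * (w s * s ^+ n)%:E)))%E.
    apply: eq_integral => s _; rewrite /f_ /S /series/= mulr_sumr -sumEFin.
    by apply: eq_bigr => n _; rewrite -EFinM exprMn; congr _%:E; ring.
  rewrite integral_sum; [|exact: measurableT|by move=> n; exact: integrableZl].
  rewrite /series/= mulr_suml -sumEFin; apply: eq_bigr => n _.
  rewrite integralZl; [|exact: measurableT|exact: iw].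
  rewrite Iw -EFinM; congr _%:E; rewrite /binomial_coef.
  have := rising_gt0 n bd0; move: (rising (b + d) n) (rising b n) (rising a n) => x1 x2 x3 x10.
  have n0 : n`!%:R != 0 :> R by rewrite pnatr_eq0 -lt0n fact_gt0.
  by field; rewrite n0 gt_eqF.
have [intf H] := dominated_cvg_pointwise mf_ f_f ig f_le.
have fin : (\int[leb]_s f s)%E \is a fin_num by exact: integrable_fin_num.
have Be0 : 0 < Be by rewrite divr_gt0 ?mulr_gt0 ?Gamma_gt0.
rewrite -[LHS](fineK fin); rewrite -[X in _ --> X](fineK fin) in H.
congr _%:E; set h := series _ in If_.
have H1 : (fun N => h N * Be * Be^-1) @ \oo --> fine (\int[leb]_s f s)%E / Be.
  apply: cvgM; last exact: cvg_cst.
  rewrite (_ : (fun N => h N * Be) = fine \o (fun N => \int[leb]_s f_ N s)%E).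
    exact: fine_cvg.
  by apply/funext => N /=; rewrite If_.
have H2 : h @ \oo --> fine (\int[leb]_s f s)%E / Be.
  by move: H1; under eq_fun do rewrite (mulfK (lt0r_neq0 Be0)).
rewrite /hyp2F1 -/h (cvg_lim _ H2)//.
by rewrite (divfK (lt0r_neq0 Be0)).
Unshelve. all: by end_near. Qed.

End EulerIntegral.

(** * Hypergeometric form of the Bessel kernel *)

Section KernelFormula.
Context {R : realType}.
Local Notation leb := (@lebesgue_measure R).

(** The substitution v = w - (w-u) s turns the composition integral into
Euler's integral. *)
Lemma bessel_core_hyp2F1 (mu g u w : R) : 0 < g -> -1 < g + mu -> 0 < u < w ->
  bessel_core mu g u w =
  ((w - u) `^ (2 * g - 1) * w `^ (- g) / Gamma (2 * g) *
    hyp2F1 (g + mu) g (2 * g) (1 - u / w))%:E.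
Proof.
move=> g0 a1 /andP[u0 uw].
have w0 : 0 < w by exact: lt_trans uw.
have wu0 : 0 < w - u by lra.
have gg := Gamma_gt0 g0.
set t := 1 - u / w.
have t01 : 0 <= t < 1.
  rewrite /t subr_ge0 ler_pdivrMr// mul1r ltW//=.
  by rewrite ltrBlDr ltrDl divr_gt0.
pose c0 := w `^ mu / (Gamma g * Gamma g).
pose f v : \bar R := (c0 * (ppow (g - 1) (v - u) * ppow (g - 1) (w - v) *
   ppow (- (g + mu)) v))%:E.
have c00 : 0 <= c0 by rewrite mulr_ge0 ?powR_ge0// invr_ge0 mulr_ge0 ?ltW.
have f0 v : (0 <= f v)%E.
  by rewrite lee_fin; apply: mulr_ge0 => //; rewrite !mulr_ge0 ?ppow_ge0.
have mf : measurable_fun setT f.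
  have mp (s : R) := @measurable_ppow R s.
  by rewrite /f; meas.
transitivity (\int[leb]_v f v)%E.
  apply: eq_integral => v _; rewrite -!EFinM; congr _%:E.
  rewrite (ppowE _ u0) (ppowE _ w0) powRr0 /c0.
  have [v0|v0] := ltP 0 v; last by rewrite !(ppow_npos _ v0) !(mulr0,mul0r).
  rewrite (ppowE 0 v0) powRr0 (_ : - g - mu = - (g + mu)); last by ring.
  by field; rewrite (gt_eqF gg).
have := @ge0_integral_affine R (- (w - u)) w f.
rewrite oppr_eq0 (gt_eqF wu0) => /(_ isT mf f0).
rewrite normrN (gtr0_norm wu0) => H.
transitivity ((w - u)%:E * \int[leb]_s f (- (w - u) * s + w)%R)%E.
  by rewrite H muleA -EFinM divff ?gt_eqF// mul1e.
have c10 : 0 <= c0 * (w - u) `^ (g - 1) * (w - u) `^ (g - 1) * w `^ (- (g + mu)).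
  by do 3 (apply: mulr_ge0; last exact: powR_ge0).
transitivity ((w - u)%:E * ((c0 * (w - u) `^ (g - 1) * (w - u) `^ (g - 1) *
    w `^ (- (g + mu)))%:E * \int[leb]_s (ppow (g - 1) s * ppow (g - 1) (1 - s) *
    (1 - t * s) `^ (- (g + mu)))%:E))%E.
  congr (_ * _)%E; rewrite -ge0_integralZl; [|exact: measurableT| | |by rewrite lee_fin];
    last 2 first.
  - have mp (s : R) := @measurable_ppow R s.
    by meas.
  - by move=> s _; rewrite lee_fin !mulr_ge0 ?ppow_ge0 ?powR_ge0.
  apply: eq_integral => s _; rewrite /f -EFinM; congr _%:E.
  rewrite (_ : - (w - u) * s + w - u = (w - u) * (1 - s)); last by ring.
  rewrite (_ : w - (- (w - u) * s + w) = (w - u) * s); last by ring.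
  rewrite (_ : - (w - u) * s + w = w * (1 - t * s)); last first.
    by rewrite /t; field; rewrite (gt_eqF w0).
  rewrite !ppowMl//.
  have [s0|s0] := ltP 0 s; last by rewrite !(ppow_npos _ s0) !(mulr0,mul0r).
  have [s1|s1] := ltP s 1; last first.
    by rewrite (@ppow_npos _ _ (1 - s)) ?subr_le0// !(mulr0,mul0r).
  rewrite (@ppowE _ _ (1 - t * s)); last first.
    have [t0 t1] := andP t01; rewrite subr_gt0.
    by apply: le_lt_trans s1; rewrite ler_piMl// ltW.
  ring.
rewrite (@euler_integral _ (g + mu) g g t)// -!EFinM; congr _%:E.
rewrite (_ : g + g = 2 * g); last by ring.
have g20 : 0 < 2 * g by rewrite mulr_gt0.
have -> : (w - u) `^ (2 * g - 1) =
    (w - u) * (w - u) `^ (g - 1) * (w - u) `^ (g - 1).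
  rewrite -[X in _ = X * _ * _](powRr1 (ltW wu0)) !powRE// -!expRD; congr expR; ring.
have -> : w `^ (- g) = w `^ mu * w `^ (- (g + mu)).
  rewrite !powRE// -!expRD; congr expR; ring.
rewrite /c0; have := Gamma_gt0 g20; move: (Gamma (2 * g)) => G2 hG2.
by field; rewrite (gt_eqF gg) (gt_eqF hG2).
Qed.

Lemma bessel_kernelE (nu g x z : R) : 0 <= nu -> 0 < g -> 0 < x < z ->
  bessel_kernel nu g x z =
  ((Gamma (2 * g))^-1 * (((z ^+ 2 - x ^+ 2) / (2 * z)) `^ (2 * g - 1) *
    hyp2F1 (g + (nu - 1) / 2) g (2 * g) (1 - x ^+ 2 / z ^+ 2)))%:E.
Proof.
move=> nu0 g0 /andP[x0 xz]; have z0 : 0 < z by exact: lt_trans xz.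
have x20 : 0 < x ^+ 2 by rewrite exprn_gt0.
have z20 : 0 < z ^+ 2 by rewrite exprn_gt0.
have xz2 : x ^+ 2 < z ^+ 2 by rewrite ltr_pXn2r// nnegrE ltW.
have d0 : 0 < z ^+ 2 - x ^+ 2 by rewrite subr_gt0.
rewrite /bessel_kernel bessel_core_hyp2F1//; [|lra|by rewrite x20].
rewrite -EFinM; congr _%:E; rewrite !ppowE// powRr0 (powRr1 (ltW z0)).
have -> : ((z ^+ 2 - x ^+ 2) / (2 * z)) `^ (2 * g - 1) =
    2 * 4 `^ (- g) * z * ((z ^+ 2 - x ^+ 2) `^ (2 * g - 1) * (z ^+ 2) `^ (- g)).
  rewrite -[X in X * 4 `^ _](@powRr1 _ 2)// -[X in _ * X * (_ * _)](powRr1 (ltW z0)).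
  have z2 : 0 < 2 * z by rewrite mulr_gt0.
  rewrite !powRE ?divr_gt0// lnM ?posrE ?invr_gt0// lnV ?posrE// lnM ?posrE//.
  rewrite (_ : 4 = 2 * 2); last by ring.
  rewrite lnM ?posrE// lnXn// -!expRD; congr expR; ring.
ring.
Qed.

End KernelFormula.

(** * Fubini for composable kernels *)

Section KernelOperators.
Context {R : realType}.
Local Notation leb := (@lebesgue_measure R).
Local Open Scope ereal_scope.

Section Composition.
Variables (a c f : R -> R) (b : R -> R -> R).
Hypothesis ma : measurable_fun setT a.
Hypothesis mb : measurable_fun setT (fun p : R * R => b p.1 p.2).
Hypothesis mf : measurable_fun setT f.
Hypothesis a0 : forall y, (0 <= a y)%R.
Hypothesis b0 : forall y z, (0 <= b y z)%R.
Hypothesis abc : forall z, \int[leb]_y (a y * b y z)%:E = (c z)%:E.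
Hypothesis icf : leb.-integrable setT (fun z => (c z * f z)%:E).

Let F (p : R * R) := (a p.1 * b p.1 p.2 * f p.2)%:E.

Let mF : measurable_fun setT F.
Proof.
apply/measurable_EFinP; apply: measurable_funM; last by meas.
by apply: measurable_funM => //; meas.
Qed.

Let c0 z : (0 <= c z)%R.
Proof.
by rewrite -lee_fin -abc; apply: integral_ge0 => y _; rewrite lee_fin mulr_ge0.
Qed.

Let mab z : measurable_fun setT (fun y => (a y * b y z)%:E).
Proof.
apply/measurable_EFinP; apply: measurable_funM => //.
exact: (measurableT_comp mb (measurable_pair2 z)).
Qed.

Let iF : (leb \x leb)%E.-integrable setT F.
Proof.
apply/(integrable21ltyP leb leb mF).
rewrite (_ : \int[leb]_z _ = \int[leb]_z `|(c z * f z)%:E|).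
  by move/integrableP : icf => [].
apply: eq_integral => z _.
rewrite abse_EFin normrM (ger0_norm (c0 z)) mulrC EFinM -abc.
rewrite -ge0_integralZl; [|exact: measurableT|exact: mab| |by rewrite lee_fin];
  last by move=> y _; rewrite lee_fin mulr_ge0.
apply: eq_integral => y _; rewrite /F abse_EFin -EFinM normrM mulrC.
by rewrite (@ger0_norm _ (a y * b y z)%R) ?mulr_ge0.
Qed.

Lemma kernel_compose_ae :
  {ae leb, forall y, leb.-integrable setT (fun z => (a y * b y z * f z)%:E)}.
Proof. exact: (ae_integrable1 iF). Qed.

(** Exchanging the integrals is legitimate because Tonelli bounds the double
integral of absolute values by that of c |f|, finite by hypothesis. The
function h stands for the inner operator applied to f; it matters only where
the outer kernel does not vanish. *)
Lemma kernel_compose (h : R -> R) :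
  (forall y, a y != 0%R -> leb.-integrable setT (fun z => (b y z * f z)%:E) /\
     h y = fine (\int[leb]_z (b y z * f z)%:E)) ->
  leb.-integrable setT (fun y => (a y * h y)%:E) /\
  \int[leb]_y (a y * h y)%:E = \int[leb]_z (c z * f z)%:E.
Proof.
move=> hE.
have E y : \int[leb]_z F (y, z) = (a y * h y)%:E.
  have [ay|/hE[ib ->]] := eqVneq (a y) 0%R.
    by rewrite ay mul0r; apply: integral0_eq => z _; rewrite /F/= ay !mul0r.
  rewrite EFinM fineK; last exact: integrable_fin_num.
  rewrite -integralZl//; apply: eq_integral => z _.
  by rewrite /F/= -EFinM mulrA.
have EE : fubini_F leb F = (fun y => (a y * h y)%:E) by apply/funext => y; exact: E.
split; first by rewrite -EE; exact: integrable_fubini_F.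
transitivity (\int[leb]_y fubini_F leb F y); first by rewrite EE.
rewrite (Fubini iF); apply: eq_integral => z _.
rewrite mulrC EFinM -abc -integralZl.
- by apply: eq_integral => y _; rewrite /F/= -EFinM mulrC.
- exact: measurableT.
apply/integrableP; split; first exact: mab.
under eq_integral => y _ do rewrite gee0_abs ?lee_fin ?mulr_ge0//.
by rewrite abc ltry.
Qed.

End Composition.

Lemma ae_exists_itv (P : R -> Prop) (u v : R) : (u < v)%R ->
  {ae leb, forall y, P y} -> exists y, (u < y < v)%R /\ P y.
Proof.
move=> uv [N [mN N0 PN]]; apply: contrapT => H.
have sub : `]u, v[%classic `<=` N.
  move=> y; rewrite /= in_itv/= => uyv; apply: PN => /= Py.
  by apply: H; exists y.
have : leb `]u, v[%classic <= 0.
  by rewrite -N0; apply: le_measure; rewrite ?inE.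
by rewrite lebesgue_measure_itv/= lte_fin uv -EFinB lee_fin; lra.
Qed.

(** Quantities comparable up to a factor rho have comparable powers, for
exponents of either sign. *)
Lemma powR_comparable (rho x y p : R) : (0 < x)%R -> (0 < y)%R ->
  (x <= rho * y)%R -> (y <= rho * x)%R -> (x `^ p <= rho `^ `|p| * y `^ p)%R.
Proof.
move=> x0 y0 xy yx.
have r0 : (0 < rho)%R by rewrite -(pmulr_lgt0 _ y0); exact: lt_le_trans xy.
rewrite !powRE// -expRD ler_expR.
have := xy; rewrite -ler_ln ?posrE ?mulr_gt0// lnM ?posrE// => h1.
have := yx; rewrite -ler_ln ?posrE ?mulr_gt0// lnM ?posrE// => h2.
have [p0|p0] := leP 0%R p; first by rewrite (ger0_norm p0) -mulrDr ler_wpM2l.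
by have := ler_wnM2l (ltW p0) h2; rewrite (ltr0_norm p0) mulNr mulrDr; lra.
Qed.

End KernelOperators.

(** * Bounds on the Bessel kernel *)

Section Estimates.
Context {R : realType}.
Local Notation leb := (@lebesgue_measure R).

(** Outside 0 < x < z it vanishes, so integrals against it run over the line. *)
Definition right_kernel (nu g x z : R) : R := fine (bessel_kernel nu g x z).

Variables (nu g : R).
Hypotheses (nu0 : 0 <= nu) (g0 : 0 < g).

Let g20 : 0 < 2 * g. Proof. by rewrite mulr_gt0. Qed.

Lemma right_kernelE x z : (right_kernel nu g x z)%:E = bessel_kernel nu g x z.
Proof.
rewrite /right_kernel fineK//.
have [xz|xz] := boolP (0 < x < z); first by rewrite bessel_kernelE.
by rewrite bessel_kernel0.
Qed.

Lemma right_kernel_ge0 x z : 0 <= right_kernel nu g x z.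
Proof. by rewrite -lee_fin right_kernelE (nonneg_kernel_bessel nu g0).2. Qed.

Lemma right_kernel0 x z : ~~ (0 < x < z) -> right_kernel nu g x z = 0.
Proof. by move=> xz; rewrite /right_kernel bessel_kernel0. Qed.

Lemma measurable_right_kernel :
  measurable_fun setT (fun p : R * R => right_kernel nu g p.1 p.2).
Proof.
apply/measurable_EFinP.
rewrite (_ : _ \o _ = (fun p : R * R => bessel_kernel nu g p.1 p.2)).
  exact: (nonneg_kernel_bessel nu g0).1.
by apply/funext => p; rewrite /= right_kernelE.
Qed.

Lemma right_kernel_hyp2F1 x z : 0 < x < z ->
  right_kernel nu g x z =
  (Gamma (2 * g))^-1 * (((z ^+ 2 - x ^+ 2) / (2 * z)) `^ (2 * g - 1) *
    hyp2F1 (g + (nu - 1) / 2) g (2 * g) (1 - x ^+ 2 / z ^+ 2)).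
Proof. by move=> xz; rewrite /right_kernel bessel_kernelE. Qed.

Let a := g + (nu - 1) / 2.
Let Be := Gamma g * Gamma g / Gamma (2 * g).
Let Be0 : 0 < Be.
Proof. by rewrite divr_gt0 ?mulr_gt0 ?Gamma_gt0. Qed.

(** Comparable values of 1 - t s make the integrands of Euler's integral
comparable. *)
Lemma le_hyp2F1 (rho t t' : R) : 0 <= t < 1 -> 0 <= t' < 1 ->
  (forall s, 0 < s < 1 -> 1 - t * s <= rho * (1 - t' * s)) ->
  (forall s, 0 < s < 1 -> 1 - t' * s <= rho * (1 - t * s)) ->
  hyp2F1 a g (2 * g) t <= rho `^ `|a| * hyp2F1 a g (2 * g) t'.
Proof.
move=> t01 t01' h1 h2.
have a1 : -1 < a by rewrite /a; move: nu0 g0 => h3 h4; lra.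
rewrite -(ler_pM2r Be0) -mulrA -lee_fin [leRHS]EFinM.
have := euler_integral a1 g0 g0 t01; have := euler_integral a1 g0 g0 t01'.
rewrite (_ : g + g = 2 * g); last by ring.
rewrite -/Be => <- <-.
have mp (s : R) := @measurable_ppow R s.
have mF u : measurable_fun setT (fun s : R =>
    (ppow (g - 1) s * ppow (g - 1) (1 - s) * (1 - u * s) `^ (- a))%:E) by meas.
have F0 u s : (0 <= (ppow (g - 1) s * ppow (g - 1) (1 - s) * (1 - u * s) `^ (- a))%:E)%E.
  by rewrite lee_fin !mulr_ge0 ?ppow_ge0 ?powR_ge0.
rewrite -ge0_integralZl; [|exact: measurableT|exact: mF|by move=> s _; exact: F0|
  by rewrite lee_fin powR_ge0].
apply: ge0_le_integral => //.
- exact: mF.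
- by apply: emeasurable_funM => //; exact: mF.
- move=> s _; rewrite -EFinM lee_fin.
  have [s0|s0] := ltP 0 s; last by rewrite !(ppow_npos _ s0) !mul0r mulr0.
  have [s1|s1] := ltP s 1; last first.
    by rewrite (@ppow_npos _ _ (1 - s)) ?subr_le0// !(mulr0,mul0r).
  rewrite [leRHS]mulrCA ler_wpM2l ?mulr_ge0 ?ppow_ge0//.
  have pos u : 0 <= u < 1 -> 0 < 1 - u * s.
    move=> /andP[u0 u1]; rewrite subr_gt0; apply: le_lt_trans s1.
    by rewrite ler_piMl// ltW.
  rewrite -(normrN a); apply: powR_comparable; [exact: pos|exact: pos| |].
    by apply: h1; rewrite s0.
  by apply: h2; rewrite s0.
Qed.

(** By comparison with t = 0, where the Gauss series is 1. *)
Lemma hyp2F1_gt0 t : 0 <= t < 1 -> 0 < hyp2F1 a g (2 * g) t.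
Proof.
move=> t01; have [t0 t1] := andP t01.
have a1 : -1 < a by rewrite /a; move: nu0 g0 => h3 h4; lra.
have z01 : 0 <= (0 : R) < 1 by rewrite lexx ltr01.
have h0 : hyp2F1 a g (2 * g) 0 = 1.
  apply: (mulIf (lt0r_neq0 Be0)); apply: EFin_inj.
  rewrite mul1r /Be (_ : 2 * g = g + g); last by ring.
  rewrite -(euler_integral a1 g0 g0 z01) -eBetaE//; apply: eq_integral => s _.
  by rewrite mul0r subr0 powR1 mulr1 EFinM.
have r0 : 0 < (1 - t)^-1 by rewrite invr_gt0 subr_gt0.
have := @le_hyp2F1 (1 - t)^-1 0 t z01 t01; rewrite h0 => H.
have : 0 < (1 - t)^-1 `^ `|a| * hyp2F1 a g (2 * g) t.
  apply: lt_le_trans ltr01 (H _ _) => s /andP[s0 s1]; rewrite mul0r subr0.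
    rewrite mulrC ler_pdivlMr ?subr_gt0// mul1r lerD2l lerN2.
    by rewrite ler_piMr// ltW.
  rewrite mulr1 (@le_trans _ _ 1)//; first by rewrite gerBl mulr_ge0// ltW.
  by rewrite invf_ge1 ?subr_gt0// gerBl.
by rewrite pmulr_rgt0// powR_gt0.
Qed.

Lemma right_kernel_gt0 x z : 0 < x < z -> 0 < right_kernel nu g x z.
Proof.
move=> xz; rewrite right_kernel_hyp2F1//; have [x0 x_z] := andP xz.
have z0 : 0 < z by exact: lt_trans x_z.
have x20 : 0 < x ^+ 2 by rewrite exprn_gt0.
have z20 : 0 < z ^+ 2 by rewrite exprn_gt0.
have xz2 : x ^+ 2 < z ^+ 2 by rewrite ltr_pXn2r// nnegrE ltW.
apply: mulr_gt0; first by rewrite invr_gt0 Gamma_gt0.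
apply: mulr_gt0; first by rewrite powR_gt0// divr_gt0 ?subr_gt0 ?mulr_gt0.
apply: hyp2F1_gt0; rewrite subr_ge0 ler_pdivrMr// mul1r ltW//=.
by rewrite ltrBlDr ltrDl divr_gt0.
Qed.

(** For z >= 2x the factors z^2 - x0^2 and 1 - t s of the two kernels are
comparable uniformly in z, with ratios at most 2 and (x/x0)^2. *)
Lemma le_right_kernel_shift (x0 x : R) : 0 < x0 < x ->
  exists C, forall z, 2 * x <= z -> right_kernel nu g x z <= C * right_kernel nu g x0 z.
Proof.
move=> /andP[x00 x0x]; have x_gt0 : 0 < x by exact: lt_trans x0x.
pose rho := (x / x0) ^+ 2.
have rho1 : 1 <= rho.
  by rewrite /rho exprn_ege1// ler_pdivlMr// mul1r ltW.
exists (2 `^ `|2 * g - 1| * rho `^ `|a|) => z xz.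
have z0 : 0 < z by lra.
rewrite !right_kernel_hyp2F1; [|lra|lra].
have xz2 : x ^+ 2 <= z ^+ 2 / 4.
  rewrite ler_pdivlMr//; rewrite -[4](_ : 2 ^+ 2 = 4); last by ring.
  rewrite mulrC -exprMn lerXn2r ?nnegrE//; lra.
have x02 : 0 < x0 ^+ 2 by rewrite exprn_gt0.
have x0x2 : x0 ^+ 2 < x ^+ 2 by rewrite ltr_pXn2r// nnegrE ltW.
have z2 : 0 < z ^+ 2 by rewrite exprn_gt0.
have t_itv u : 0 < u -> u <= z ^+ 2 / 4 -> 0 <= 1 - u / z ^+ 2 < 1.
  move=> u0 uz; rewrite subr_ge0 ler_pdivrMr// mul1r.
  rewrite ltrBlDr ltrDl divr_gt0// andbT; lra.
have H1 : ((z ^+ 2 - x ^+ 2) / (2 * z)) `^ (2 * g - 1) <=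
    2 `^ `|2 * g - 1| * ((z ^+ 2 - x0 ^+ 2) / (2 * z)) `^ (2 * g - 1).
  have z20 : 0 < (2 * z)^-1 by rewrite invr_gt0 mulr_gt0.
  apply: powR_comparable; rewrite ?mulr_gt0//; try lra.
    rewrite mulrA ler_wpM2r ?ltW//; lra.
  rewrite mulrA ler_wpM2r ?ltW//; lra.
have H2 : hyp2F1 a g (2 * g) (1 - x ^+ 2 / z ^+ 2) <=
    rho `^ `|a| * hyp2F1 a g (2 * g) (1 - x0 ^+ 2 / z ^+ 2).
  have E (u s : R) : 1 - (1 - u / z ^+ 2) * s = (1 - s) + s * (u / z ^+ 2) by ring.
  apply: le_hyp2F1; [apply: t_itv; lra|apply: t_itv; lra| |] => s /andP[s0 s1];
    rewrite !E.
    have -> : x ^+ 2 = rho * x0 ^+ 2.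
      by rewrite /rho exprMn exprVn divfK// gt_eqF.
    rewrite mulrDr -mulrA; apply: lerD; first by rewrite ler_peMl// subr_ge0 ltW.
    by rewrite mulrCA.
  apply: (@le_trans _ _ (1 - s + s * (x ^+ 2 / z ^+ 2))).
    rewrite lerD2l ler_wpM2l ?ltW// ltr_pM2r ?invr_gt0//.
  rewrite ler_peMl// addr_ge0 ?subr_ge0 ?ltW// mulr_gt0// divr_gt0//; lra.
rewrite -/a [leRHS]mulrCA ler_wpM2l; [by []|by rewrite invr_ge0 ltW ?Gamma_gt0|].
rewrite mulrACA; apply: ler_pM; [exact: powR_ge0| |exact: H1|exact: H2].
by apply: ltW; apply: hyp2F1_gt0; apply: t_itv => //; rewrite exprn_gt0.
Qed.

(** Bounding the middle weight by a constant leaves a product of two Weyl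
integrals, which has an explicit kernel. *)
Lemma le_bessel_core (mu u w m : R) : 0 < u < w ->
  (forall v, u < v < w -> v `^ (- g - mu) * w `^ mu <= m) ->
  (bessel_core mu g u w <= m%:E * riesz 0 (2 * g) 0 u w)%E.
Proof.
move=> uw hm.
have [u0 u_w] := andP uw.
have kr (p b c : R) : 0 < b -> nonneg_kernel (riesz p b c).
  by move=> b0; exact: nonneg_kernel_riesz.
have m0 : 0 <= m.
  apply: le_trans (hm ((u + w) / 2) _); last by apply/andP; split; lra.
  by rewrite mulr_ge0 ?powR_ge0.
have r0 p c x y : (0 <= riesz p g c x y)%E by case: (kr p g c g0) => _; exact.
have gg : 2 * g = g + g by ring.
rewrite gg -(kcomp_riesz 0 0 g0 g0).
have mR b c : measurable_fun setT (fun v => riesz 0 g b u v * riesz 0 g c v w)%E.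
  apply: emeasurable_funM.
    by apply: nonneg_kernel_l; exact: kr.
  by apply: nonneg_kernel_r; exact: kr.
rewrite /bessel_core /kcomp -ge0_integralZl; [|exact: measurableT| | |by rewrite lee_fin];
  last 2 first.
- exact: mR.
- by move=> v _; apply: mule_ge0; exact: r0.
apply: ge0_le_integral.
- exact: measurableT.
- by move=> v _; apply: mule_ge0; exact: r0.
- exact: mR.
- by apply: emeasurable_funM => //; exact: mR.
move=> v _.
have [uv|uv] := boolP (0 < u < v); last by rewrite !(riesz0 _ _ _ uv) !mul0e mule0.
have [vw|vw] := boolP (0 < v < w); last by rewrite !(riesz0 _ _ _ vw) !mule0.
have [/andP[_ u_v] /andP[v0 v_w]] := (uv, vw).
have w0 : 0 < w by exact: lt_trans v_w.
rewrite /riesz -!EFinM lee_fin !ppowE ?subr_gt0//.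
rewrite !powRr0.
have -> : 1 * (v - u) `^ (g - 1) * v `^ (- g - mu) / Gamma g *
    (1 * (w - v) `^ (g - 1) * w `^ mu / Gamma g) =
  v `^ (- g - mu) * w `^ mu * ((v - u) `^ (g - 1) * (w - v) `^ (g - 1) *
    (Gamma g)^-1 ^+ 2) by ring.
have -> : m * (1 * (v - u) `^ (g - 1) * 1 / Gamma g *
    (1 * (w - v) `^ (g - 1) * 1 / Gamma g)) =
  m * ((v - u) `^ (g - 1) * (w - v) `^ (g - 1) * (Gamma g)^-1 ^+ 2) by ring.
apply: ler_wpM2r; first by rewrite !mulr_ge0 ?powR_ge0 ?exprn_ge0 ?invr_ge0 ?ltW ?Gamma_gt0.
by apply: hm; rewrite u_v.
Qed.

Lemma right_kernel_near (x : R) : 0 < x ->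
  exists C, forall z, x < z -> z <= 2 * x ->
    right_kernel nu g x z <= C * ppow (2 * g - 1) (z - x).
Proof.
move=> x0; set mu := (nu - 1) / 2.
pose m := 4 `^ `|- g - mu| * (x ^+ 2) `^ (- g - mu) *
  (4 `^ `|mu| * (x ^+ 2) `^ mu).
pose c := 2 * 4 `^ (- g) * (2 * x) * m / Gamma (2 * g).
pose d := 2 `^ `|2 * g - 1| * (2 * x) `^ (2 * g - 1).
exists (c * d) => z xz zx.
have z0 : 0 < z by lra.
have x20 : 0 < x ^+ 2 by rewrite exprn_gt0.
have xz2 : x ^+ 2 < z ^+ 2 by rewrite ltr_pXn2r// nnegrE ltW.
have z4 : z ^+ 2 <= 4 * x ^+ 2.
  rewrite (_ : 4 * x ^+ 2 = (2 * x) ^+ 2); last by ring.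
  by rewrite lerXn2r// nnegrE; lra.
have m0 : 0 <= m by rewrite !mulr_ge0 ?powR_ge0.
have hm v : x ^+ 2 < v < z ^+ 2 -> v `^ (- g - mu) * (z ^+ 2) `^ mu <= m.
  move=> /andP[xv vz].
  apply: ler_pM; rewrite ?powR_ge0//; apply: powR_comparable => //; try lra.
rewrite -lee_fin right_kernelE /bessel_kernel -/mu.
have xz2' : 0 < x ^+ 2 < z ^+ 2 by rewrite x20.
apply: (@le_trans _ _ ((2 * 4 `^ (- g) * ppow 0 x * ppow 1 z)%:E *
    (m%:E * riesz 0 (2 * g) 0 (x ^+ 2) (z ^+ 2)))%E).
  apply: lee_wpmul2l; first by rewrite lee_fin !mulr_ge0 ?powR_ge0 ?ppow_ge0.
  exact: le_bessel_core.
have zx0 : 0 < z - x by lra.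
have g2 := Gamma_gt0 g20.
have z20 : 0 < z ^+ 2 by exact: lt_trans xz2.
rewrite /riesz -!EFinM lee_fin !ppowE ?subr_gt0//.
rewrite !powRr0 !mulr1 !mul1r (powRr1 (ltW z0)).
rewrite (_ : z ^+ 2 - x ^+ 2 = (z - x) * (z + x)); last by ring.
rewrite powRM; [|lra|lra].
have -> : 2 * 4 `^ (- g) * z * (m * ((z - x) `^ (2 * g - 1) *
    (z + x) `^ (2 * g - 1) / Gamma (2 * g))) =
  2 * 4 `^ (- g) * m / Gamma (2 * g) * (z - x) `^ (2 * g - 1) *
   (z * (z + x) `^ (2 * g - 1)) by ring.
have -> : c * d * (z - x) `^ (2 * g - 1) =
  2 * 4 `^ (- g) * m / Gamma (2 * g) * (z - x) `^ (2 * g - 1) *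
   (2 * x * d) by rewrite /c; ring.
apply: ler_wpM2l.
  by rewrite !mulr_ge0 ?powR_ge0// invr_ge0 ltW.
apply: ler_pM => //; [lra|exact: powR_ge0|].
apply: powR_comparable; lra.
Qed.

End Estimates.

(** * Both fractional integrals as kernel operators *)

Section Operators.
Context {R : realType}.
Local Notation leb := (@lebesgue_measure R).

(** Passes from an integrand on an interval to a kernel extended by 0, moving
the normalization G inside. *)
Lemma integral_scaled_restrict (D : set R) (G : R) (F k : R -> R) :
  measurable D -> 0 < G -> (forall y, D y -> F y = G * k y) ->
  (forall y, ~ D y -> k y = 0) ->
  (leb.-integrable D (fun y => (F y)%:E) <->
   leb.-integrable setT (fun y => (k y)%:E)) /\
  (leb.-integrable setT (fun y => (k y)%:E) ->
   G^-1 * (\int[leb]_(y in D) F y) = fine (\int[leb]_y (k y)%:E)%E).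
Proof.
move=> mD G0 FE k0.
have E : (fun y => (F y)%:E) \_ D = (fun y => G%:E * (k y)%:E)%E.
  apply/funext => y; rewrite patchE; case: ifPn => [/set_mem/FE -> //|].
  by move=> /negP yD; rewrite k0 ?mule0// => Dy; apply: yD; rewrite inE.
have I := @integrable_mkcond _ _ _ leb D (fun y => (F y)%:E) mD.
rewrite E in I; split.
  split=> i; last by apply: I.2; exact: integrableZl.
  have := I.1 i.
  move=> /(integrableZl measurableT G^-1).
  by under eq_fun do rewrite -!EFinM (mulKf (lt0r_neq0 G0)).
move=> i; rewrite /Rintegral integral_mkcond E integralZl//.
rewrite fineM//=; last exact: integrable_fin_num.
by rewrite mulrA mulVf ?gt_eqF// mul1r.
Qed.

Lemma right_kernel_semigroup (nu a b x z : R) : 0 <= nu -> 0 < a -> 0 < b ->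
  (\int[leb]_y (right_kernel nu a x y * right_kernel nu b y z)%:E =
   (right_kernel nu (a + b) x z)%:E)%E.
Proof.
move=> nu0 a0 b0; rewrite right_kernelE ?addr_gt0// -bessel_kernel_semigroup//.
by apply: eq_integral => y _; rewrite EFinM !right_kernelE.
Qed.

Lemma bessel_rightE (nu g x : R) (f : R -> R) : 0 <= nu -> 0 < g -> 0 < x ->
  (leb.-integrable `]x, +oo[ (fun y => (bessel_right_integrand nu g f x y)%:E) <->
   leb.-integrable setT (fun y => (right_kernel nu g x y * f y)%:E)) /\
  (leb.-integrable setT (fun y => (right_kernel nu g x y * f y)%:E) ->
   bessel_right nu g f x = fine (\int[leb]_y (right_kernel nu g x y * f y)%:E)%E).
Proof.
move=> nu0 g0 x0.
have G0 : 0 < Gamma (2 * g) by rewrite Gamma_gt0// mulr_gt0.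
apply: integral_scaled_restrict => // y; rewrite /= in_itv/= andbT.
  move=> xy; rewrite right_kernel_hyp2F1//; last by rewrite x0.
  rewrite /bessel_right_integrand mulrA mulrA mulfV ?gt_eqF// mul1r; ring.
by move=> xy; rewrite right_kernel0 ?mul0r// x0; exact/negP.
Qed.

(** The factor (y/x)^nu makes this the adjoint of the right kernel with respect
to the weight y^nu dy. *)
Definition left_kernel (nu g x y : R) : R :=
  ppow nu y * ppow (- nu) x * right_kernel nu g y x.

Lemma bessel_leftE (nu g x : R) (f : R -> R) : 0 <= nu -> 0 < g -> 0 < x ->
  (leb.-integrable `]0, x[ (fun y => (bessel_left_integrand nu g f x y)%:E) <->
   leb.-integrable setT (fun y => (left_kernel nu g x y * f y)%:E)) /\
  (leb.-integrable setT (fun y => (left_kernel nu g x y * f y)%:E) ->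
   bessel_left nu g f x = fine (\int[leb]_y (left_kernel nu g x y * f y)%:E)%E).
Proof.
move=> nu0 g0 x0.
have G0 : 0 < Gamma (2 * g) by rewrite Gamma_gt0// mulr_gt0.
apply: integral_scaled_restrict => // y; rewrite /= in_itv/=.
  move=> /andP[y0 yx]; rewrite /left_kernel right_kernel_hyp2F1//; last by rewrite y0.
  rewrite /bessel_left_integrand !ppowE// powRM ?invr_ge0 ?ltW// powRN.
  rewrite -(powR_inv1 (ltW x0)) -powRrM mulN1r powRN.
  by field; rewrite !gt_eqF// powR_gt0.
by move=> xy; rewrite /left_kernel right_kernel0 ?mulr0 ?mul0r//; exact/negP.
Qed.

Lemma left_kernel_semigroup (nu a b x z : R) : 0 <= nu -> 0 < a -> 0 < b ->
  (\int[leb]_y (left_kernel nu a x y * left_kernel nu b y z)%:E =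
   (left_kernel nu (a + b) x z)%:E)%E.
Proof.
move=> nu0 a0 b0; rewrite /left_kernel [a + b]addrC EFinM -right_kernel_semigroup//.
rewrite -ge0_integralZl; [|exact: measurableT| | |]; last 3 first.
- apply/measurable_EFinP; apply: measurable_funM.
    exact: (measurableT_comp (measurable_right_kernel nu0 b0) (measurable_pair1 z)).
  exact: (measurableT_comp (measurable_right_kernel nu0 a0) (measurable_pair2 x)).
- by move=> y _; rewrite lee_fin mulr_ge0// right_kernel_ge0.
- by rewrite lee_fin mulr_ge0 ?ppow_ge0.
apply: eq_integral => y _; rewrite -EFinM; congr _%:E.
have [y0|y0] := ltP 0 y; last first.
  by rewrite !(ppow_npos _ y0) (@right_kernel0 _ nu a y) ?(mul0r,mulr0)// ltNge y0.
have E : ppow nu y * ppow (- nu) y = 1 by rewrite ppowD subrr ppowE// powRr0.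
transitivity (ppow nu z * ppow (- nu) x * (ppow nu y * ppow (- nu) y) *
  (right_kernel nu b z y * right_kernel nu a y x)); first by ring.
by rewrite E mulr1.
Qed.

Lemma measurable_left_kernel (nu g : R) : 0 <= nu -> 0 < g ->
  measurable_fun setT (fun p : R * R => left_kernel nu g p.1 p.2).
Proof.
move=> nu0 g0; have mp (s : R) := @measurable_ppow R s.
apply: measurable_funM; first by meas.
have ms : measurable_fun setT (fun p : R * R => (p.2, p.1)).
  by apply: measurable_fun_pair; meas.
exact: (measurableT_comp (measurable_right_kernel nu0 g0) ms).
Qed.

Lemma left_kernel_ge0 (nu g x y : R) : 0 <= nu -> 0 < g -> 0 <= left_kernel nu g x y.
Proof. by move=> nu0 g0; rewrite !mulr_ge0 ?ppow_ge0 ?right_kernel_ge0. Qed.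

(** In the variables y^2, x^2 and after exchanging the integrals, the inner
integral of v^mu (s-v)^(g-1) cancels the weight s^(-g-mu), and a second Beta
integral remains. The inner one converges at 0 because mu > -1. *)
Lemma integral_left_kernel_lty (nu g x : R) : 0 <= nu -> 0 < g -> 0 < x ->
  (\int[leb]_y (left_kernel nu g x y)%:E < +oo)%E.
Proof.
move=> nu0 g0 x0; set mu := (nu - 1) / 2.
have mu1 : 0 < mu + 1 by rewrite /mu; lra.
have mp (s : R) := @measurable_ppow R s.
have x2 : 0 < x ^+ 2 by rewrite exprn_gt0.
have kc := @nonneg_kernel_bessel_core R mu g g0.
pose c0 := ppow (- nu) x * (2 * 4 `^ (- g) * ppow 1 x).
have c00 : 0 <= c0 by rewrite !mulr_ge0 ?ppow_ge0 ?powR_ge0.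
pose F v := ((ppow mu v)%:E * bessel_core mu g v (x ^+ 2))%E.
have F0 v : (0 <= F v)%E by apply: mule_ge0; [exact: ppow_ge0E|exact: kc.2].
have mF : measurable_fun setT F.
  by apply: emeasurable_funM; [meas|exact: nonneg_kernel_r].
suff [r rE] : exists r : R, (\int[leb]_v F v = r%:E)%E.
  rewrite (_ : (\int[leb]_y _)%E = (c0%:E * ((2^-1)%:E * r%:E))%E).
    by rewrite -!EFinM ltry.
  transitivity (\int[leb]_y (c0%:E * ((ppow 1 y)%:E * F (y ^+ 2)%R)))%E.
    apply: eq_integral => y _.
    rewrite /left_kernel EFinM right_kernelE// /bessel_kernel -/mu /F !muleA -!EFinM.
    congr (_%:E * _)%E; rewrite /c0.
    have [y0|y0] := ltP 0 y; last by rewrite !(ppow_npos _ y0) !(mulr0,mul0r).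
    rewrite !(ppowE _ y0) powRr0 (ppowE mu (exprn_gt0 2 y0)).
    have -> : y `^ nu = y `^ 1 * (y ^+ 2) `^ mu.
      rewrite !powRE ?exprn_gt0// lnXn// -expRD; congr expR.
      by rewrite (_ : nu = 1 + 2 * mu) ?mulrDl; [ring|rewrite /mu; field].
    by ring.
  rewrite ge0_integralZl; [|exact: measurableT| | |by rewrite lee_fin]; last 2 first.
  - apply: emeasurable_funM; first by meas.
    by apply: (measurableT_comp mF); exact: measurable_funX.
  - by move=> y _; apply: mule_ge0 => //; exact: ppow_ge0E.
  rewrite integral_square// -rE; congr (_ * (_ * _))%E.
  by apply: eq_integral => v _; rewrite /F muleA -EFinM ppowD add0r.
have kr (p b c : R) : 0 < b -> nonneg_kernel (riesz p b c).
  by move=> b0; exact: nonneg_kernel_riesz.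
pose X := x ^+ 2; pose b := - g - mu.
pose B1 := Gamma (mu + 1) * Gamma g / Gamma (mu + 1 + g).
pose B2 := Gamma 1 * Gamma g / Gamma (1 + g).
pose c1 := B1 / Gamma g * (ppow mu X / Gamma g).
have gg := ltW (Gamma_gt0 g0).
have B10 : 0 <= B1.
  apply: divr_ge0; last exact: ltW (Gamma_gt0 (addr_gt0 mu1 g0)).
  by apply: mulr_ge0; [exact: ltW (Gamma_gt0 mu1)|].
have c10 : 0 <= c1.
  by apply: mulr_ge0; apply: divr_ge0; [| |exact: ppow_ge0|].
exists (c1 * (ppow (1 + g - 1) X * B2)).
have mI s : measurable_fun setT (fun v => (ppow (mu + 1 - 1) v)%:E * (ppow (g - 1) (s - v))%:E)%E.
  by meas.
have inner s : (\int[leb]_v ((ppow mu v)%:E * riesz 0 g b v s) =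
    (B1 / Gamma g * ppow 0 s)%:E)%E.
  transitivity ((ppow b s / Gamma g)%:E * \int[leb]_v
     ((ppow (mu + 1 - 1) v)%:E * (ppow (g - 1) (s - v))%:E))%E.
    rewrite -ge0_integralZl; [|exact: measurableT|exact: mI| |]; last 2 first.
    - by move=> v _; apply: mule_ge0; exact: ppow_ge0E.
    - by rewrite lee_fin divr_ge0 ?ppow_ge0 ?ltW ?Gamma_gt0.
    apply: eq_integral => v _; rewrite -!EFinM; congr _%:E.
    have -> : ppow (mu + 1 - 1) v = ppow mu v * ppow 0 v by rewrite ppowD; congr ppow; ring.
    ring.
  rewrite convolution_ppow eBetaE// -!EFinM; congr _%:E.
  have -> : ppow 0 s = ppow b s * ppow (mu + 1 + g - 1) s.
    by rewrite ppowD /b; congr ppow; ring.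
  by rewrite -/B1; ring.
transitivity (\int[leb]_v \int[leb]_s
    ((ppow mu v)%:E * riesz 0 g b v s * riesz 0 g mu s X))%E.
  apply: eq_integral => v _; rewrite /F /bessel_core /kcomp.
  rewrite -ge0_integralZl; [|exact: measurableT| | |exact: ppow_ge0E]; last 2 first.
  - apply: emeasurable_funM; first by apply: nonneg_kernel_l; exact: kr.
    by apply: nonneg_kernel_r; exact: kr.
  - by move=> s _; apply: mule_ge0; [exact: (kr 0 g b g0).2|exact: (kr 0 g mu g0).2].
  by apply: eq_integral => s _; rewrite muleA.
have r0 c u v : (0 <= riesz 0 g c u v)%E by exact: (kr 0 g c g0).2.
rewrite tonelli; last 2 first.
- apply: emeasurable_funM; first apply: emeasurable_funM.
  + by meas.
  + exact: (kr 0 g b g0).1.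
  + by apply: nonneg_kernel_comp; [exact: kr|meas|meas].
- by move=> v s; apply: mule_ge0 => //; apply: mule_ge0 => //; exact: ppow_ge0E.
transitivity (\int[leb]_s (c1%:E *
    ((ppow (1 - 1) s)%:E * (ppow (g - 1) (X - s))%:E)))%E.
  apply: eq_integral => s _.
  rewrite ge0_integralZr; [|exact: measurableT| | |exact: r0]; last 2 first.
  - by apply: emeasurable_funM; [meas|apply: nonneg_kernel_r; exact: kr].
  - by move=> v _; apply: mule_ge0 => //; exact: ppow_ge0E.
  rewrite inner -!EFinM subrr; congr _%:E; rewrite /c1.
  have E0 : ppow 0 s * ppow 0 s = ppow 0 s by rewrite ppowD addr0.
  by rewrite -[X in _ = _ * (X * _)]E0; ring.
rewrite ge0_integralZl; [|exact: measurableT| | |by rewrite lee_fin]; last 2 first.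
- by meas.
- by move=> s _; apply: mule_ge0; exact: ppow_ge0E.
by rewrite convolution_ppow eBetaE// -!EFinM.
Qed.

End Operators.

(** * The index laws *)

Section MainTheorem.
Context {R : realType}.
Local Notation leb := (@lebesgue_measure R).

Lemma C_on_continuous k (D : set R) (f : R -> R) : C_on k D f ->
  {within D, continuous f}.
Proof.
case=> d [d0 _ cd]; apply: subspace_eq_continuous (cd 0%N (leq0n _)).
by move=> x /set_mem Dx; exact: d0.
Qed.

Lemma continuous_bounded_segment (f : R -> R) (u v : R) : u <= v ->
  {within `[u, v], continuous f} ->
  exists M, forall x, u <= x <= v -> `|f x| <= M.
Proof.
move=> uv cf.
have cn : {within `[u, v], continuous (fun x => `|f x|)}.
  by move=> x; apply: (continuous_comp (cf x)); exact: norm_continuous.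
have [c _ cM] := EVT_max uv cn.
by exists `|f c| => x xuv; apply: cM; rewrite in_itv.
Qed.

Let pos : set R := `]0, +oo[%classic.

Lemma measurable_restrict_pos (f : R -> R) : {within pos, continuous f} ->
  measurable_fun setT (f \_ pos).
Proof.
move=> cf; have mpos : measurable pos by exact: measurable_itv.
apply: (measurable_restrictT f mpos).1.
exact: subspace_continuous_measurable_fun.
Qed.

Lemma restrict_posE (f : R -> R) x : 0 < x -> (f \_ pos) x = f x.
Proof. by move=> x0; rewrite patchE mem_set//= /pos/= in_itv/= x0. Qed.

Section Right.
Variables (nu alpha beta : R) (f : R -> R).
Hypotheses (nu0 : 0 <= nu) (a0 : 0 < alpha) (b0 : 0 < beta).
Hypothesis cf : {within pos, continuous f}.
Hypothesis cvg_f : bessel_right_cvg nu (alpha + beta) f.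

Let ab0 : 0 < alpha + beta. Proof. by rewrite addr_gt0. Qed.

Let f0 := f \_ pos.
Let mf0 : measurable_fun setT f0. Proof. exact: measurable_restrict_pos. Qed.

Let kf0 g x y : right_kernel nu g x y * f y = right_kernel nu g x y * f0 y.
Proof.
have [/andP[x0 xy]|xy] := boolP (0 < x < y); last by rewrite right_kernel0// !mul0r.
by rewrite /f0 restrict_posE//; exact: lt_trans xy.
Qed.

Let kf0E g x : (fun y => (right_kernel nu g x y * f y)%:E) =
  (fun y => (right_kernel nu g x y * f0 y)%:E).
Proof. by apply/funext => y; rewrite kf0. Qed.

Let icf x : 0 < x ->
  leb.-integrable setT (fun z => (right_kernel nu (alpha + beta) x z * f0 z)%:E).
Proof.
move=> x0; rewrite -kf0E.
exact: ((bessel_rightE f nu0 ab0 x0).1.1 (cvg_f x0)).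
Qed.

Let mkr g x : 0 < g -> measurable_fun setT (right_kernel nu g x).
Proof.
by move=> g0; exact: (measurableT_comp (measurable_right_kernel nu0 g0) (measurable_pair1 x)).
Qed.

Let ibf x : 0 < x -> leb.-integrable setT (fun z => (right_kernel nu beta x z * f0 z)%:E).
Proof.
move=> x0.
have xh0 : 0 < x / 2 by rewrite divr_gt0.
(* Tonelli at x/2 yields a base point y0 < x where order beta converges. *)
have [y0 [/andP[xy0 y0x] iy0]] := ae_exists_itv (ltac:(lra) : x / 2 < x)
  (kernel_compose_ae (mkr (x / 2) a0) (measurable_right_kernel nu0 b0) mf0
    (fun y => right_kernel_ge0 nu0 a0 (x / 2) y) (right_kernel_ge0 nu0 b0)
    (fun z => right_kernel_semigroup (x / 2) z nu0 a0 b0) (icf xh0)).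
have {}iy0 : leb.-integrable setT (fun z => (right_kernel nu beta y0 z * f0 z)%:E).
  have := integrableZl measurableT (right_kernel nu alpha (x / 2) y0)^-1 iy0.
  have k0 : right_kernel nu alpha (x / 2) y0 != 0 
    by apply: lt0r_neq0; apply: right_kernel_gt0 => //; rewrite xh0.
  by under eq_fun do rewrite -EFinM -mulrA (mulKf k0).
have [C1 hC1] := le_right_kernel_shift nu0 b0 (ltac:(apply/andP; split; lra) : 0 < y0 < x).
have [C2 hC2] := right_kernel_near nu0 b0 x0.
have [M hM] : exists M, forall z, x <= z <= 2 * x -> `|f z| <= M.
  apply: continuous_bounded_segment; first lra.
  apply: continuous_subspaceW cf => z; rewrite /pos/= !in_itv/= andbT => /andP[xz _].
  exact: lt_le_trans xz.
have b20 : 0 < 2 * beta by rewrite mulr_gt0.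
(* The exponential makes the local singularity a Gamma integrand; it costs the
   factor exp x on ]x, 2x[. *)
pose G z := ppow (2 * beta - 1) (z - x) * expR (- (z - x)).
have iG : leb.-integrable setT (fun z => (G z)%:E).
  have mG : measurable_fun setT (fun z => (G z)%:E).
    have := measurable_eGammaF (2 * beta) => H.
    by apply: (measurableT_comp H); exact: measurable_funB.
  apply/integrableP; split => //.
  have G0 z : (0 <= (G z)%:E)%E by rewrite lee_fin mulr_ge0 ?ppow_ge0 ?expR_ge0.
  under eq_integral do rewrite (gee0_abs (G0 _)).
  rewrite -(@ge0_integral_shift _ x)//.
  under eq_integral do rewrite /G addrK.
  exact: eGamma_lty.
have M0 : 0 <= M.
  by apply: le_trans (hM x _) => //; rewrite lexx/=; lra.
have := integrableD measurableT
  (integrableZl measurableT `|C1| (integrable_abse iy0))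
  (integrableZl measurableT (`|C2| * M * expR x) iG).
apply: le_integrable => //.
  by apply/measurable_EFinP; apply: measurable_funM => //; exact: mkr.
move=> z _; rewrite /= lee_fin.
set T1 := `|C1| * _; set T2 := _ * M * _ * _.
have T10 : 0 <= T1 by rewrite mulr_ge0.
have G0 : 0 <= G z by rewrite mulr_ge0 ?ppow_ge0 ?expR_ge0.
have T20 : 0 <= T2.
  by rewrite /T2; apply: mulr_ge0 => //; rewrite !mulr_ge0 ?expR_ge0.
rewrite (@ger0_norm _ (T1 + T2)) ?addr_ge0// normrM (ger0_norm (right_kernel_ge0 nu0 b0 _ _)).
have [zx|xz] := leP z x.
  by rewrite right_kernel0 ?(le_gtF zx) ?andbF// mul0r addr_ge0.
have [z2|z2] := leP (2 * x) z.
  apply: (@le_trans _ _ T1); last by rewrite lerDl.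
  rewrite /T1 normrM (ger0_norm (right_kernel_ge0 nu0 b0 _ _)) mulrA ler_wpM2r//.
  rewrite (le_trans (hC1 _ z2))// ler_wpM2r ?ler_norm//.
  exact: right_kernel_ge0.
apply: (@le_trans _ _ T2); last by rewrite lerDr.
rewrite /f0 restrict_posE; last exact: lt_trans xz.
have hk : right_kernel nu beta x z <= `|C2| * (expR x * G z).
  rewrite (le_trans (hC2 _ xz (ltW z2)))// (le_trans (ler_wpM2r (ppow_ge0 _ _) (ler_norm C2)))//.
  rewrite ler_wpM2l// /G mulrCA ler_peMr ?ppow_ge0// -expRD.
  by rewrite -expR0 ler_expR; lra.
rewrite (_ : T2 = `|C2| * (expR x * G z) * M); last by rewrite /T2; ring.
apply: ler_pM => //; first exact: right_kernel_ge0.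
by apply: hM; rewrite !ltW.
Qed.

Let right_beta x : 0 < x ->
  leb.-integrable setT (fun z => (right_kernel nu beta x z * f z)%:E).
Proof. by move=> x0; rewrite kf0E; exact: ibf. Qed.

Lemma bessel_right_cvg_beta : bessel_right_cvg nu beta f.
Proof.
by move=> x x0; apply: (bessel_rightE f nu0 b0 x0).1.2; exact: right_beta.
Qed.

Lemma bessel_right_compose x : 0 < x ->
  leb.-integrable setT (fun y => (right_kernel nu alpha x y * bessel_right nu beta f y)%:E) /\
  (\int[leb]_y (right_kernel nu alpha x y * bessel_right nu beta f y)%:E =
   \int[leb]_z (right_kernel nu (alpha + beta) x z * f z)%:E)%E.
Proof.
move=> x0; rewrite kf0E.
apply: (kernel_compose (mkr x a0) (measurable_right_kernel nu0 b0) mf0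
  (fun y => right_kernel_ge0 nu0 a0 x y) (right_kernel_ge0 nu0 b0)
  (fun z => right_kernel_semigroup x z nu0 a0 b0) (icf x0)).
move=> y kxy; have y0 : 0 < y.
  have [y0|y0] := ltP 0 y => //; move: kxy; rewrite right_kernel0 ?eqxx//.
  apply/negP => /andP[_ xy]; lra.
split; first exact: ibf.
rewrite (bessel_rightE f nu0 b0 y0).2; last exact: right_beta.
by rewrite kf0E.
Qed.

Lemma bessel_right_index_law :
  [/\ bessel_right_cvg nu beta f,
      bessel_right_cvg nu alpha (bessel_right nu beta f)
    & forall x : R, 0 < x ->
        bessel_right nu alpha (bessel_right nu beta f) x
        = bessel_right nu (alpha + beta) f x].
Proof.
split; first exact: bessel_right_cvg_beta.
- move=> x x0; apply: (bessel_rightE _ nu0 a0 x0).1.2.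
  exact: (bessel_right_compose x0).1.
- move=> x x0; have [i e] := bessel_right_compose x0.
  rewrite (bessel_rightE _ nu0 a0 x0).2// e.
  by rewrite (bessel_rightE _ nu0 ab0 x0).2// kf0E; exact: icf.
Qed.

End Right.

Section Left.
Variables (nu alpha beta : R) (f : R -> R).
Hypotheses (nu0 : 0 <= nu) (a0 : 0 < alpha) (b0 : 0 < beta).
Hypothesis cf : {within `[0, +oo[%classic, continuous f}.

Let ab0 : 0 < alpha + beta. Proof. by rewrite addr_gt0. Qed.

Let f0 := f \_ pos.
Let mf0 : measurable_fun setT f0.
Proof.
apply: measurable_restrict_pos; apply: continuous_subspaceW cf => x.
by rewrite /pos/= !in_itv/= !andbT => /ltW.
Qed.

Let kf0 g x y : left_kernel nu g x y * f y = left_kernel nu g x y * f0 y.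
Proof.
have [y0|y0] := ltP 0 y; first by rewrite /f0 restrict_posE.
by rewrite /left_kernel ppow_npos// !mul0r.
Qed.

Let kf0E g x : (fun y => (left_kernel nu g x y * f y)%:E) =
  (fun y => (left_kernel nu g x y * f0 y)%:E).
Proof. by apply/funext => y; rewrite kf0. Qed.

Let mkl g x : 0 < g -> measurable_fun setT (left_kernel nu g x).
Proof.
by move=> g0; exact: (measurableT_comp (measurable_left_kernel nu0 g0) (measurable_pair1 x)).
Qed.

Let icf g x : 0 < g -> 0 < x ->
  leb.-integrable setT (fun z => (left_kernel nu g x z * f0 z)%:E).
Proof.
move=> g0 x0.
have [M hM] : exists M, forall z, 0 <= z <= x -> `|f z| <= M.
  apply: continuous_bounded_segment; first exact: ltW.
  by apply: continuous_subspaceW cf => z; rewrite /= !in_itv/= andbT => /andP[].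
have ik : leb.-integrable setT (fun z => (left_kernel nu g x z)%:E).
  apply/integrableP; split; first by apply/measurable_EFinP; exact: mkl.
  have k0 z : (0 <= (left_kernel nu g x z)%:E)%E by rewrite lee_fin left_kernel_ge0.
  under eq_integral do rewrite (gee0_abs (k0 _)).
  exact: integral_left_kernel_lty.
have := integrableZl measurableT M ik.
apply: le_integrable => //.
  by apply/measurable_EFinP; apply: measurable_funM => //; exact: mkl.
move=> z _; rewrite /= lee_fin.
have [/andP[z0 zx]|zx] := boolP (0 < z < x); last first.
  by rewrite /left_kernel right_kernel0// mulr0 mul0r normr0.
rewrite !normrM mulrC ler_wpM2r// /f0 restrict_posE//.
by rewrite (le_trans (hM z _)) ?ler_norm// !ltW.
Qed.

Let left_cvg g x : 0 < g -> 0 < x ->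
  leb.-integrable setT (fun z => (left_kernel nu g x z * f z)%:E).
Proof. by move=> g0 x0; rewrite kf0E; exact: icf. Qed.

Lemma bessel_left_cvg_of_continuous g : 0 < g -> bessel_left_cvg nu g f.
Proof.
by move=> g0 x x0; apply: (bessel_leftE f nu0 g0 x0).1.2; exact: left_cvg.
Qed.

Lemma bessel_left_compose x : 0 < x ->
  leb.-integrable setT (fun y => (left_kernel nu alpha x y * bessel_left nu beta f y)%:E) /\
  (\int[leb]_y (left_kernel nu alpha x y * bessel_left nu beta f y)%:E =
   \int[leb]_z (left_kernel nu (alpha + beta) x z * f z)%:E)%E.
Proof.
move=> x0; rewrite kf0E.
apply: (kernel_compose (mkl x a0) (measurable_left_kernel nu0 b0) mf0
  (fun y => left_kernel_ge0 x y nu0 a0) (fun y z => left_kernel_ge0 y z nu0 b0)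
  (fun z => left_kernel_semigroup x z nu0 a0 b0) (icf ab0 x0)).
move=> y kxy; have y0 : 0 < y.
  have [y0|y0] := ltP 0 y => //; move: kxy.
  by rewrite /left_kernel ppow_npos// !mul0r eqxx.
split; first exact: icf.
rewrite (bessel_leftE f nu0 b0 y0).2; last exact: left_cvg.
by rewrite kf0E.
Qed.

Lemma bessel_left_index_law :
  [/\ bessel_left_cvg nu beta f,
      bessel_left_cvg nu alpha (bessel_left nu beta f),
      bessel_left_cvg nu (alpha + beta) f
    & forall x : R, 0 < x ->
        bessel_left nu alpha (bessel_left nu beta f) x
        = bessel_left nu (alpha + beta) f x].
Proof.
split; [exact: bessel_left_cvg_of_continuous| |exact: bessel_left_cvg_of_continuous|].
- move=> x x0; apply: (bessel_leftE _ nu0 a0 x0).1.2.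
  exact: (bessel_left_compose x0).1.
- move=> x x0; have [i e] := bessel_left_compose x0.
  rewrite (bessel_leftE _ nu0 a0 x0).2// e.
  by rewrite (bessel_leftE _ nu0 ab0 x0).2//; exact: left_cvg.
Qed.

End Left.
End MainTheorem.

Theorem theorem4p2 (R : realType) (nu alpha beta : R)
    (hnu : 0 <= nu) (halpha : 0 < alpha) (hbeta : 0 < beta) :
  (forall f : R -> R,
     C_on (Num.truncn (2 * (alpha + beta))).+1 `]0, +oo[ f ->
     bessel_right_cvg nu (alpha + beta) f ->
     [/\ bessel_right_cvg nu beta f,
         bessel_right_cvg nu alpha (bessel_right nu beta f)
       & forall x : R, 0 < x ->
           bessel_right nu alpha (bessel_right nu beta f) x
           = bessel_right nu (alpha + beta) f x])
  /\
  (forall f : R -> R,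
     C_on (Num.truncn (2 * (alpha + beta))).+1 `[0, +oo[ f ->
     [/\ bessel_left_cvg nu beta f,
         bessel_left_cvg nu alpha (bessel_left nu beta f),
         bessel_left_cvg nu (alpha + beta) f
       & forall x : R, 0 < x ->
           bessel_left nu alpha (bessel_left nu beta f) x
           = bessel_left nu (alpha + beta) f x]).
Proof.
split=> f /C_on_continuous cf; first exact: bessel_right_index_law.
exact: bessel_left_index_law.
Qed.
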